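(* Let $m=2k$ with $k\in\mathbb{N}$, and consider the even-order heat equation $$\frac{\partial u(t,x)}{\partial t}=(-1)^{\frac m2+1}\frac{\partial^m u(t,x)}{\partial x^m},\qquad t>0,\ x\in\mathbb{R},$$ with random initial condition $u(0,x)=\eta(x)=M(x)+\xi(x)$. Its solution is the random field $$u(t,x)=\int_{\mathbb{R}} M(x-y)\,u_m(t,y)\,dy+\int_{\mathbb{R}} e^{i\lambda x-\lambda^m t}\sqrt{f(\lambda)}\,W(d\lambda),$$ where $u_m(t,y)=\frac{1}{2\pi}\int_{\mathbb{R}}e^{-i\alpha y-\alpha^m t}\,d\alpha$ is the fundamental solution. Suppose the covariance function of $\xi$ satisfies Assumption B with $A_0=0$. For $\varepsilon>0$ define $$U_\varepsilon(t,x)=\varepsilon^{-1/4}\Big(u\big(t\varepsilon^{-m/2},x\varepsilon^{-1/2}\big)-\mathbb{E}\,u\big(t\varepsilon^{-m/2},x\varepsilon^{-1/2}\big)\Big),\qquad t>0,\ x\in\mathbb{R}.$$ Then, as $\varepsilon\to0$, the finite-dimensional distributions of $U_\varepsilon$ converge weakly to those of the zero-mean Gaussian random field $$U_0(t,x)=\sqrt{C}\int_{\mathbb{R}}e^{i\lambda x-\lambda^m t}\,W(d\lambda),\qquad C:=\sum_{j=1}^n c_1(\kappa_j)A_jK_{\frac{\kappa_j-1}{2}}(|w_j|)\,|w_j|^{\frac{\kappa_j-1}{2}},$$ whose covariance function is $$\operatorname{Cov}(U_0(t,x),U_0(t',x'))=C\int_{\mathbb{R}}\cos(\lambda(x-x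'))e^{-(t+t')\lambda^m}d\lambda=\frac{2\sqrt{\pi}\,C}{m(t+t')^{1/m}}\;{}_1\Psi_1\!\left[\begin{array}{c}(1/m,\,2/m)\\(1/2,\,1)\end{array};-\frac{(x-x')^2}{4(t+t')^{2/m}}\right].$$
   Context: $(\Omega,\mathscr F,\mathbb P)$ is a complete probability space. $M:\mathbb{R}\to\mathbb{R}$ is a deterministic function for which the convolution integrals above are well defined. $\xi(x)$, $x\in\mathbb{R}$, is a real-valued, measurable, mean-square continuous, stationary Gaussian process with $\mathbb{E}\xi(x)=0$, $\mathbb{E}\xi^2(x)=1$, absolutely continuous spectral measure with spectral density $f$, and spectral representation $\xi(x)=\int_{\mathbb{R}}e^{i\lambda x}\sqrt{f(\lambda)}\,W(d\lambda)$, where $W$ is a complex Gaussian white-noise random measure on $\mathbb{R}$ chosen symmetric about the origin (so that all fields are real-valued), integrals being understood in $L_2(\Omega)$. Assumption B: the covariance function of $\xi$ is $r(x)=\sum_{j=0}^n A_j\frac{\cos(w_jx)}{(1+x^2)^{\kappa_j/2}}$, $x\in\mathbb{R}$, where $A_j\ge0$, $\sum_{j=0}^nA_j=1$, $w_0=0$, $w_j\neq0$ for $j\ge1$, and $\kappa_j\in(0,1)$ for $j=0,\dots,n$. Its spectral density is $$f(\lambda)=\sum_{j=0}^n\frac{c_1(\kappa_j)}{2}A_j\left(\frac{K_{\frac{\kappa_j-1}{2}}(|\lambda+w_j|)}{|\lambda+w_j|^{\frac{1-\kappa_j}{2}}}+\frac{K_{\frac{\kappa_j-1}{2}}(|\lambda-w_j|)}{|\lambda-w_j|^{\frac{1-\kappa_j}{2}}}\right),$$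 with $c_1(\kappa)=2^{\frac{1-\kappa}{2}}/(\sqrt{\pi}\,\Gamma(\kappa/2))$ and $K_\nu$ the modified Bessel function of the second kind. The Fox–Wright function is ${}_p\Psi_q\!\left[\begin{array}{c}(\alpha_1,A_1),\dots,(\alpha_p,A_p)\\(\beta_1,B_1),\dots,(\beta_q,B_q)\end{array};z\right]=\sum_{n=0}^\infty\frac{\prod_{j=1}^p\Gamma(\alpha_j+A_jn)}{\prod_{k=1}^q\Gamma(\beta_k+B_kn)}\frac{z^n}{n!}$ (with $A_j,B_k>0$, $1+\sum B_k-\sum A_j>0$). *)

(* Defs.v *)
From HB Require Import structures.
From mathcomp Require Import all_boot all_order all_algebra.
From mathcomp Require Import all_classical all_reals all_analysis.
Set Implicit Arguments. Unset Strict Implicit. Unset Printing Implicit Defensive.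
Import Order.TTheory GRing.Theory Num.Theory.
Import numFieldNormedType.Exports.
Local Open Scope classical_set_scope.
Local Open Scope ring_scope.

Section Defs.
Variable R : realType.
Notation leb := (@lebesgue_measure R).

Definition coshR (s : R) : R := (expR s + expR (- s)) / 2.

Definition GammaR (a : R) : R :=
  Rintegral leb `]0%R, +oo[ (fun s => powR s (a - 1) * expR (- s)).

Definition BesselK (nu z : R) : R :=
  Rintegral leb `[0%R, +oo[ (fun s => expR (- (z * coshR s)) * coshR (nu * s)).

Definition c1 (kap : R) : R :=
  powR 2 ((1 - kap) / 2) / (Num.sqrt pi * GammaR (kap / 2)).

Definition FoxWright11 (a A b B z : R) : R :=
  limn (series (fun n : nat =>
    GammaR (a + A * n%:R) / GammaR (b + B * n%:R) * z ^+ n / (n`!)%:R)).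

Definition covB (n : nat) (A w kap : 'I_n.+1 -> R) (x : R) : R :=
  \sum_(j < n.+1) A j * cos (w j * x) / powR (1 + x ^+ 2) (kap j / 2).

Definition spec_density (n : nat) (A w kap : 'I_n.+1 -> R) (l : R) : R :=
  \sum_(j < n.+1) c1 (kap j) / 2 * A j *
    (BesselK ((kap j - 1) / 2) `|l + w j| / powR `|l + w j| ((1 - kap j) / 2)
   + BesselK ((kap j - 1) / 2) `|l - w j| / powR `|l - w j| ((1 - kap j) / 2)).

Definition Cconst (n : nat) (A w kap : 'I_n.+1 -> R) : R :=
  \sum_(j < n.+1 | (0 < j)%N)
    c1 (kap j) * A j * BesselK ((kap j - 1) / 2) `|w j| * powR `|w j| ((kap j - 1) / 2).

(* A complex integrand h = h.1 + i h.2 that is Hermitian (h(-l) = conj h(l))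
   and square integrable w.r.t. Lebesgue measure. *)
Definition hermitian_L2 (h : (R -> R) * (R -> R)) : Prop :=
  [/\ measurable_fun setT h.1, measurable_fun setT h.2,
      (forall l, h.1 (- l) = h.1 l) /\ (forall l, h.2 (- l) = - h.2 l),
      leb.-integrable setT (fun l => (h.1 l ^+ 2)%:E) &
      leb.-integrable setT (fun l => (h.2 l ^+ 2)%:E)].

(* real part of the L2 inner product  int h conj(g) dl *)
Definition inner2 (h g : (R -> R) * (R -> R)) : R :=
  Rintegral leb setT (fun l => h.1 l * g.1 l + h.2 l * g.2 l).

Definition centered_gaussian d (T : measurableType d) (P : probability T R)
    (X : T -> R) (v : R) : Prop :=
  measurable_fun setT X /\
  (if v == 0 then P (X @^-1` [set 0]) = 1%E
   else forall B, measurable B ->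
          P (X @^-1` B) = normal_prob 0 (Num.sqrt v) B).

(* I h = int h(l) W(dl) for a complex Gaussian white noise W on R (Lebesgue
   control measure) chosen symmetric, i.e. the stochastic (Wiener) integral map:
   on Hermitian L2 integrands it takes real values, and the family of these
   integrals is jointly centered Gaussian with
   E[I h I g] = int h conj(g) dl. *)
Definition white_noise_integral d (T : measurableType d) (P : probability T R)
    (I : (R -> R) * (R -> R) -> T -> R) : Prop :=
  forall (N : nat) (h : 'I_N -> (R -> R) * (R -> R)) (c : 'I_N -> R),
    (forall i, hermitian_L2 (h i)) ->
    centered_gaussian P (fun om => \sum_(i < N) c i * I (h i) om)
      (\sum_(i < N) \sum_(j < N) c i * c j * inner2 (h i) (h j)).

(* the integrand  l |-> e^{i l x - l^m t} g(l) *)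
Definition heat_integrand (m : nat) (g : R -> R) (t x : R) : (R -> R) * (R -> R) :=
  (fun l => cos (l * x) * expR (- (l ^+ m * t)) * g l,
   fun l => sin (l * x) * expR (- (l ^+ m * t)) * g l).

(* fundamental solution u_m(t,y) = (1/2pi) int e^{-i a y - a^m t} da
   (its imaginary part -int sin(a y) e^{-a^m t} da vanishes, the integrand
   being odd; we write the real part) *)
Definition fund_sol (m : nat) (t y : R) : R :=
  (2 * pi)^-1 * Rintegral leb setT (fun a => cos (a * y) * expR (- (a ^+ m * t))).

Definition heat_solution (m : nat) (M f : R -> R) T
    (I : (R -> R) * (R -> R) -> T -> R) (t x : R) : T -> R :=
  fun om => Rintegral leb setT (fun y => M (x - y) * fund_sol m t y)
            + I (heat_integrand m (fun l => Num.sqrt (f l)) t x) om.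

Definition rescaled_field d (T : measurableType d) (P : probability T R)
    (m : nat) (M f : R -> R) (I : (R -> R) * (R -> R) -> T -> R)
    (eps t x : R) : T -> R :=
  let u := heat_solution m M f I (t * powR eps (- (m%:R / 2)))
                                 (x * powR eps (- (1 / 2))) in
  fun om => powR eps (- (1 / 4)) * (u om - fine ('E_P[u])%E).

Definition limit_field (m : nat) (C : R) T
    (I : (R -> R) * (R -> R) -> T -> R) (t x : R) : T -> R :=
  fun om => Num.sqrt C * I (heat_integrand m (fun _ => 1) t x) om.

Definition fdd_converge d (T : measurableType d) (P : probability T R)
    (X : R -> R -> R -> T -> R) (Y : R -> R -> T -> R) : Prop :=
  forall (N : nat) (pts : 'I_N -> R * R), (forall i, 0 < (pts i).1) ->
  forall phi : 'rV[R]_N -> R, continuous phi ->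
    (exists B : R, forall v, `|phi v| <= B) ->
    ('E_P[fun om => phi (\row_i X eps (pts i).1 (pts i).2 om)])%E
       @[eps --> 0^'+] -->
    ('E_P[fun om => phi (\row_i Y (pts i).1 (pts i).2 om)])%E.

End Defs.

(* Main.v *)
Require Import Defs.
From HB Require Import structures.
From mathcomp Require Import all_boot all_order all_algebra.
From mathcomp Require Import all_classical all_reals all_analysis.
From mathcomp Require Import measurable_realfun lebesgue_integral_under.
From mathcomp Require Import ring lra.
Set Implicit Arguments. Unset Strict Implicit. Unset Printing Implicit Defensive.
Import Order.TTheory GRing.Theory Num.Theory.
Import numFieldNormedType.Exports.
Local Open Scope classical_set_scope.
Local Open Scope ring_scope.

(* Write [a = eps ^ (-1/2)].  Up to its mean, the rescaled field at [(t, x)] is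
   [sqrt a] times the white-noise integral of the heat integrand at time
   [t a ^ m] and point [x a], so the rescaled vectors are centered Gaussian with
   covariances [a * int f l cos (a l (x - x')) exp (- (t + t') (a l) ^ m) dl].
   Since [A_0 = 0], the density [f] is continuous at [0] with [f 0 = C]; the
   kernel concentrates at [0] as [a] grows, and the covariances converge to
   [C * int cos (l (x - x')) exp (- (t + t') l ^ m) dl].

   For centered Gaussian vectors this implies weak convergence: expectations of
   trigonometric polynomials depend continuously on the covariance matrix, and a
   bounded continuous function is uniformly close on large boxes to trigonometric
   polynomials with the same bound (Bernstein approximation in the variables
   [sin (h x_i)], [h] small), the complement of the box being controlled by second
   moments.

   The Fox-Wright series is the cosine series integrated term by term, the
   moments of [exp (- s l ^ m)] being Gamma values. *)

(** Two obstacles shape the proof. First, [f] may blow up at the frequencies [w j] and [- w j], so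
    concentration at 0 cannot rest on a bound for [f]. Away from 0 a part of the heat factor must be
    kept to integrate [f], while the rest beats the factor [a].

    Second, the white noise is known only through the laws of linear combinations of its integrals.
    The cosine of a linear form plus a phase depends on one such combination, so its expectation is
    a one-dimensional integral; hence the choice of trigonometric polynomials as test functions.
    Variances may vanish, and writing a centered Gaussian as its standard deviation times a fixed
    one keeps these expectations continuous there.

    The Bernstein approximants are averages of values of [phi] with nonnegative weights of sum 1.
    They therefore obey the bound of [phi] on the whole space, also outside the box, where they need
    not be close to [phi]. *)

(** * Affine changes of variable and even functions *)

Section lebesgue_change_of_variable.
Context {R : realType}.
Notation leb := (@lebesgue_measure R).

Lemma measurable_affine (a b : R) : measurable_fun setT (fun x : R => a * x + b).
Proof. by apply: measurable_funD => //; exact: measurable_funM. Qed.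

(** Both sides are measures in [A], so by uniqueness of Lebesgue measure it is enough to compare
    them on intervals []u, v]]. *)
Lemma lebesgue_measure_affine (a b : R) (A : set R) : 0 < a -> measurable A ->
  leb A = (a%:E * leb ((fun x => a * x + b)%R @^-1` A))%E.
Proof.
move=> a0 mA.
pose m := mscale (NngNum (ltW a0)) (pushforward leb
  ((fun x => a * x + b) : _ -> measurableTypeR R)).
suff -> : leb A = m (measurable_affine a b) A by [].
apply: (@lebesgue_measure_unique R (m (measurable_affine a b)) _ _ mA) => _ [[u v]] _ <- /=.
rewrite /m /mscale/= /pushforward.
have -> : (fun x => a * x + b) @^-1` `]u, v] = `](u - b) / a, (v - b) / a]%classic.
  apply/seteqP; split => x /=; rewrite !in_itv/= ltr_pdivrMr// ler_pdivlMr//;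
    by move=> /andP[h1 h2]; apply/andP; split; lra.
rewrite !lebesgue_measure_itv/= !lte_fin ltr_pM2r ?invr_gt0// ltrBlDr subrK.
case: ifPn => _; last by rewrite mule0.
by rewrite -!EFinD -EFinM; congr EFin; field; exact: lt0r_neq0.
Qed.

Lemma ge0_integral_affine (a b : R) (g : R -> \bar R) : 0 < a ->
  measurable_fun setT g -> (forall x, 0 <= g x)%E ->
  (\int[leb]_x g x = a%:E * \int[leb]_x g (a * x + b)%R)%E.
Proof.
move=> a0 mg g0.
have mh := measurable_affine a b.
pose m := mscale (NngNum (ltW a0)) (pushforward leb
  ((fun x => a * x + b) : _ -> measurableTypeR R)).
rewrite (eq_measure_integral (m mh)); last first.
  by move=> A mA _; exact: lebesgue_measure_affine.
rewrite ge0_integral_mscale//=.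
by rewrite ge0_integral_pushforward.
Qed.

Lemma integrable_affine (a b : R) (g : R -> R) : 0 < a ->
  leb.-integrable setT (EFin \o g) ->
  leb.-integrable setT (EFin \o (fun x => g (a * x + b))).
Proof.
move=> a0 /integrableP[mg ig]; apply/integrableP; split.
  by apply/measurable_EFinP; apply: measurableT_comp;
    [exact/measurable_EFinP|exact: measurable_affine].
rewrite (@ge0_integral_affine a b) // in ig; last exact: measurableT_comp.
move: ig => /=.
rewrite !ltey; apply: contra => /eqP ->.
by rewrite gt0_muley ?lte_fin.
Qed.

(** The nonnegative case is applied to the positive part [p] and the negative part [n] of [g]. *)
Lemma Rintegral_affine (a b : R) (g : R -> R) : 0 < a ->
  leb.-integrable setT (EFin \o g) ->
  \int[leb]_x g x = a * \int[leb]_x g (a * x + b).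
Proof.
move=> a0 ig; have igab := integrable_affine b a0 ig.
have mg : measurable_fun setT g by case/integrableP : ig => /measurable_EFinP.
pose p x := Num.max (g x) 0; pose n x := Num.max (- g x) 0.
have mp : measurable_fun setT p by exact: measurable_maxr.
have mn : measurable_fun setT n.
  by apply: measurable_maxr => //; exact: measurableT_comp.
have p0 x : 0 <= p x by rewrite le_max lexx orbT.
have n0 x : 0 <= n x by rewrite le_max lexx orbT.
have gpn x : g x = p x - n x by rewrite /p /n; case: (leP (g x) 0); case: (leP (- g x) 0); lra.
have ple x : `|p x| <= `|g x|.
  by rewrite ger0_norm// /p ge_max normr_ge0 ler_norm.
have nle x : `|n x| <= `|g x|.
  by rewrite ger0_norm// /n ge_max normr_ge0 -normrN ler_norm.
have ip : leb.-integrable setT (EFin \o p).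
  apply: (le_integrable measurableT _ _ ig) => /=; first exact/measurable_EFinP.
  by move=> x _; rewrite lee_fin.
have in_ : leb.-integrable setT (EFin \o n).
  apply: (le_integrable measurableT _ _ ig) => /=; first exact/measurable_EFinP.
  by move=> x _; rewrite lee_fin.
have aff (h : R -> R) : measurable_fun setT h -> (forall x, 0 <= h x) ->
    leb.-integrable setT (EFin \o h) ->
    \int[leb]_x h x = a * \int[leb]_x h (a * x + b).
  move=> mh h0 ih.
  rewrite /Rintegral (@ge0_integral_affine a b (EFin \o h))//.
  - by rewrite fineM//; apply: integrable_fin_num => //; exact: (@integrable_affine a b h).
  - exact/measurable_EFinP.
under eq_Rintegral do rewrite gpn.
under [X in _ = a * X]eq_Rintegral do rewrite gpn.
rewrite !RintegralB//.
- by rewrite (aff p)// (aff n)// mulrBr.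
- exact: (@integrable_affine a b p).
- exact: (@integrable_affine a b n).
Qed.

Lemma ge0_integral_even (g : R -> \bar R) :
  measurable_fun setT g -> (forall x, 0 <= g x)%E -> (forall x, g (- x) = g x) ->
  (\int[leb]_x g x = 2%:E * \int[leb]_(x in `]0%R, +oo[) g x)%E.
Proof.
move=> mg g0 ge.
have -> : [set: R] = `]-oo, 0%R] `|` `]0%R, +oo[.
  by apply/seteqP; split => // x _ /=; rewrite !in_itv/= andbT; case: (leP x 0); [left|right].
rewrite ge0_integral_setU//=; last 2 first.
  exact: measurable_funTS.
  apply/disj_setPS => x [] /=; rewrite !in_itv/= andbT => h1 h2.
  by move: (le_lt_trans h1 h2); rewrite ltxx.
have -> : (\int[leb]_(x in `]-oo, 0%R]) g x = \int[leb]_(x in `[0%R, +oo[) g x)%E.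
  rewrite [RHS]ge0_integration_by_substitution0//.
  by apply: eq_integral => x _; rewrite ge.
rewrite -integral_itv_obnd_cbnd//; last exact: measurable_funTS.
by rewrite mule_natl mule2n.
Qed.

End lebesgue_change_of_variable.

(** * The substitution [y = s x ^ p] on the half-line *)

Section power_substitution.
Context {R : realType}.
Notation leb := (@lebesgue_measure R).

Lemma is_derive_monomial (s : R) (p : nat) (x : R) :
  is_derive x 1 (fun y : R => s * y ^+ p) (s * p%:R * x ^+ p.-1).
Proof.
have -> : (fun y : R => s * y ^+ p) = s *: ((@id R) ^+ p).
  by apply/funext => y; rewrite /= exprfctE.
by apply: is_derive_eq; rewrite /GRing.scale/= mulr1 mulrA.
Qed.

Lemma bigcup_itv_exhaust (u v : R^nat) :
  (forall n, 0 < u n) -> (forall x, 0 < x -> exists n, u n <= x <= v n) ->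
  \bigcup_n `[u n, v n]%classic = `]0, +oo[%classic.
Proof.
move=> u0 uv; apply/seteqP; split => x /=.
  by move=> [n _] /=; rewrite !in_itv/= andbT => /andP[+ _]; exact: lt_le_trans.
by rewrite in_itv/= andbT => /uv[n un]; exists n.
Qed.

(** Monotone convergence along growing compact intervals; it carries a substitution rule from
    compact intervals to the open half-line. *)
Lemma cvg_integral_exhaust (u v : R^nat) (h : R -> R) :
  (forall n, 0 < u n) -> (forall x, 0 < x -> exists n, u n <= x <= v n) ->
  (forall m n, (m <= n)%N -> u n <= u m) -> (forall m n, (m <= n)%N -> v m <= v n) ->
  {in `]0%R, +oo[, continuous h} -> (forall x, 0 < x -> 0 <= h x) ->
  (\int[leb]_(x in `[u n, v n]) (h x)%:E)%E @[n --> \oo] -->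
    (\int[leb]_(x in `]0%R, +oo[) (h x)%:E)%E.
Proof.
move=> u0 uv du iv ch h0.
rewrite -(bigcup_itv_exhaust u0 uv).
have mh : measurable_fun (`]0%R, +oo[ : set R) h.
  apply: open_continuous_measurable_fun; first exact: interval_open.
  by move=> x; rewrite inE => ?; exact: ch.
have sub n : `[u n, v n] `<=` `]0%R, +oo[.
  move=> x /=; rewrite !in_itv/= andbT => /andP[+ _]; exact: lt_le_trans.
apply: ge0_nondecreasing_set_cvg_integral => //.
- move=> m n mn; apply/subsetPset => x /=; rewrite !in_itv/= => /andP[h1 h2].
  by rewrite (le_trans (du _ _ mn))//= (le_trans h2)// iv.
- by move=> n; apply/measurable_EFinP; exact: measurable_funS mh.
- move=> n x /sub /=; rewrite in_itv/= andbT => /h0; by rewrite lee_fin.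
Qed.

(** Substitution is done on [[1/(n+1), n+1]], away from 0, where [G] may be singular. Both sides
    then converge monotonically to the half-line integrals. *)
Lemma ge0_integral_power (s : R) (p : nat) (G : R -> R) : 0 < s -> (0 < p)%N ->
  {in `]0%R, +oo[, continuous G} -> (forall x, 0 < x -> 0 <= G x) ->
  (\int[leb]_(y in `]0%R, +oo[) (G y)%:E =
   \int[leb]_(x in `]0%R, +oo[) (G (s * x ^+ p) * (s * p%:R * x ^+ p.-1))%:E)%E.
Proof.
move=> s0 p0 cG G0.
pose F := fun x : R => s * x ^+ p; pose F' := fun x : R => s * p%:R * x ^+ p.-1.
have dF x : derivable F x 1 by have [] := is_derive_monomial s p x.
have F'E : F^`()%classic = F'.
  by apply/funext => x; rewrite derive1E; have [_ ->] := is_derive_monomial s p x.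
have cF' : continuous F'.
  move=> x; apply: cvgM; first exact: cvg_cst.
  exact: exprn_continuous.
have cF : continuous F.
  move=> x; apply: cvgM; first exact: cvg_cst.
  exact: exprn_continuous.
have Fpos x : 0 < x -> 0 < F x by move=> x0; rewrite mulr_gt0// exprn_gt0.
have Fle x y : 0 <= x -> x <= y -> F x <= F y.
  by move=> x0 xy; rewrite ler_pM2l// lerXn2r// nnegrE// (le_trans x0).
have Flt x y : 0 <= x -> x < y -> F x < F y.
  by move=> x0 xy; rewrite ltr_pM2l// ltrXn2r ?gt_eqF.
pose a (n : nat) : R := n.+1%:R^-1; pose b (n : nat) : R := n.+1%:R.
have a0 n : 0 < a n by rewrite invr_gt0.
have b0 n : 0 < b n by [].
have ab n : a n <= b n.
  by rewrite (@le_trans _ _ 1)// ?invf_le1// ler1n.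
have da m n : (m <= n)%N -> a n <= a m.
  by move=> mn; rewrite lef_pV2 ?posrE// ler_nat ltnS.
have ib m n : (m <= n)%N -> b m <= b n by move=> mn; rewrite ler_nat ltnS.
have exh x : 0 < x -> exists n, a n <= x <= b n.
  move=> x0; exists (Num.bound (x + x^-1)).
  have hx : x + x^-1 < (Num.bound (x + x^-1))%:R.
    by apply: archi_boundP; rewrite addr_ge0 ?invr_ge0 ?ltW.
  have x'0 : 0 < x^-1 by rewrite invr_gt0.
  have lb : (Num.bound (x + x^-1))%:R <= b (Num.bound (x + x^-1)) by rewrite ler_nat.
  apply/andP; split; last lra.
  by rewrite /a invf_ple ?posrE//; move: lb; rewrite /b; lra.
(* The images of the intervals also exhaust the half-line: since [a n <= 1 <= b n], raising to a
   power [p >= 1] moves both endpoints outwards. *)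
have exhF y : 0 < y -> exists n, F (a n) <= y <= F (b n).
  move=> y0; have ys0 : 0 < y / s by rewrite divr_gt0.
  have [n /andP[h1 h2]] := exh _ ys0; exists n.
  have an1 : a n <= 1 by rewrite invf_le1// ler1n.
  have bn1 : 1 <= b n by rewrite ler1n.
  have sy : y = s * (y / s) by field; exact: lt0r_neq0.
  rewrite /F [X in _ <= X <= _]sy !ler_pM2l//; apply/andP; split.
    by rewrite (le_trans _ h1)// -[leRHS]expr1 ler_wiXn2l// ltW.
  by rewrite (le_trans h2)// -[leLHS]expr1 ler_weXn2l.
have subst n : (\int[leb]_(x in `[F (a n), F (b n)]) (G x)%:E =
     \int[leb]_(x in `[a n, b n]) (G (F x) * F' x)%:E)%E.
  rewrite integration_by_substitution_increasing//.
  - by apply: eq_integral => x _; rewrite F'E.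
  - move=> x y; rewrite !in_itv/= => /andP[h _] _; apply: Flt.
    by rewrite (le_trans _ h)// ltW.
  - by rewrite F'E => x _; exact: cF'.
  - by rewrite F'E; apply/cvg_ex; exists (F' (a n)); apply: cvg_at_right_filter; exact: cF'.
  - by rewrite F'E; apply/cvg_ex; exists (F' (b n)); apply: cvg_at_left_filter; exact: cF'.
  - split; first by move=> x _; exact: dF.
    by apply: cvg_at_right_filter; exact: cF.
    by apply: cvg_at_left_filter; exact: cF.
  - apply: continuous_in_subspaceT => x; rewrite inE/= in_itv/= => /andP[h _].
    apply: cG; rewrite in_itv/= andbT (lt_le_trans _ h)//; exact: Fpos.
have c1 : (\int[leb]_(x in `[F (a n), F (b n)]) (G x)%:E)%E @[n --> \oo] -->
    (\int[leb]_(x in `]0%R, +oo[) (G x)%:E)%E.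
  apply: cvg_integral_exhaust => //.
  - by move=> n; exact: Fpos.
  - by move=> m n mn; apply: Fle; [exact: ltW|exact: da].
  - by move=> m n mn; apply: Fle; [exact: ltW|exact: ib].
have c2 : (\int[leb]_(x in `[a n, b n]) (G (F x) * F' x)%:E)%E @[n --> \oo] -->
    (\int[leb]_(x in `]0%R, +oo[) (G (F x) * F' x)%:E)%E.
  apply: cvg_integral_exhaust => //.
  - move=> x; rewrite in_itv/= andbT => x0; apply: cvgM; last exact: cF'.
    apply: continuous_comp; first exact: cF.
    by apply: cG; rewrite in_itv/= andbT Fpos.
  - move=> x x0; rewrite mulr_ge0 ?G0 ?Fpos// /F' !mulr_ge0 ?exprn_ge0//; exact: ltW.
move: c1; under eq_fun do rewrite subst.
by move=> c1; exact: (cvg_unique _ c1 c2).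
Qed.

End power_substitution.

(** * Gaussian domination of integrands carrying the heat factor *)

Section gaussian_domination.
Context {R : realType}.
Notation leb := (@lebesgue_measure R).

Lemma integrable_le_gauss (g : R -> R) (C a : R) : 0 < a ->
  measurable_fun setT g -> (forall l, `|g l| <= C * expR (- (a * l ^+ 2))) ->
  leb.-integrable setT (EFin \o g).
Proof.
move=> a0 mg gC.
have sa : 0 < Num.sqrt a by rewrite sqrtr_gt0.
have ig := integrable_affine 0 sa (@integrableT_gauss R).
have := @integrableZl _ _ _ leb setT measurableT C _ ig.
apply: le_integrable => //; first exact/measurable_EFinP.
move=> l _ /=; rewrite lee_fin (le_trans (gC l))//.
rewrite /gauss_fun addr0 exprMn sqr_sqrtr; last exact: ltW.
exact: ler_norm.
Qed.

(** This replaces the heat factor of order [2 * k] by a Gaussian, at the price of a constant factor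
    [exp s]. For [l ^ 2 <= 1] the left side is nonpositive. *)
Lemma sqr_le_exprD1 (k : nat) (l : R) : (0 < k)%N -> l ^+ 2 - 1 <= l ^+ (2 * k).
Proof.
move=> k0; rewrite exprM; have y0 : 0 <= l ^+ 2 by rewrite sqr_ge0.
have [y1|y1] := leP (l ^+ 2) 1; first by rewrite (@le_trans _ _ 0) ?subr_le0// exprn_ge0.
rewrite (@le_trans _ _ (l ^+ 2))// ?gerBl// -[leLHS]expr1 ler_weXn2l//.
exact: ltW.
Qed.

Lemma expR_power_le_gauss (k : nat) (s l : R) : (0 < k)%N -> 0 <= s ->
  expR (- (s * l ^+ (2 * k))) <= expR s * expR (- (s * l ^+ 2)).
Proof.
move=> k0 s0; rewrite -expRD ler_expR.
have := ler_wpM2l s0 (sqr_le_exprD1 l k0); lra.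
Qed.

(** Completing the square: the exponents differ by [(s |l| - |x|) ^ 2 / (2 s)]. *)
Lemma expR_abs_gauss_le (x s l : R) : 0 < s ->
  expR `|l * x| * expR (- (s * l ^+ 2)) <=
  expR (x ^+ 2 / (2 * s)) * expR (- (s / 2 * l ^+ 2)).
Proof.
move=> s0; rewrite -!expRD ler_expR.
have h : 0 <= (s * `|l| - `|x|) ^+ 2 / (2 * s).
  by rewrite divr_ge0 ?sqr_ge0// mulr_ge0 ?ltW.
have e : (s * `|l| - `|x|) ^+ 2 / (2 * s) =
    s / 2 * l ^+ 2 - `|l * x| + x ^+ 2 / (2 * s).
  rewrite normrM -[l ^+ 2]real_normK ?num_real//.
  rewrite -[x ^+ 2]real_normK ?num_real//; field; exact: lt0r_neq0.
move: h; rewrite e; lra.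
Qed.

Lemma measurable_expR_power (s : R) (m : nat) :
  measurable_fun setT (fun l : R => expR (- (s * l ^+ m))).
Proof.
apply: measurableT_comp => //; apply: measurableT_comp => //.
exact: measurable_funM.
Qed.

(* Every integrand below grows at most exponentially, hence is dominated by a
   Gaussian once multiplied by the heat factor. *)
Lemma integrable_heat_exp (k : nat) (s x C : R) (g : R -> R) : (0 < k)%N -> 0 < s ->
  measurable_fun setT g -> (forall l, `|g l| <= C * expR `|l * x|) ->
  leb.-integrable setT (EFin \o (fun l => g l * expR (- (s * l ^+ (2 * k))))).
Proof.
move=> k0 s0 mg gC.
apply: (@integrable_le_gauss _ (C * (expR s * expR (x ^+ 2 / (2 * s)))) (s / 2)).
- by rewrite divr_gt0.
- by apply: measurable_funM => //; exact: measurable_expR_power.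
- move=> l; have C0 : 0 <= C.
    have := le_trans (normr_ge0 _) (gC 0).
    by rewrite mul0r normr0 expR0 mulr1.
  rewrite normrM [`|expR _|]ger0_norm ?expR_ge0//.
  rewrite (le_trans (ler_pM _ _ (gC l) (@expR_power_le_gauss k s l k0 (ltW s0))))//.
  have := ler_wpM2l (mulr_ge0 C0 (expR_ge0 s)) (@expR_abs_gauss_le x s l s0).
  lra.
Qed.

Lemma integrable_heat_bounded (k : nat) (s C : R) (g : R -> R) : (0 < k)%N -> 0 < s ->
  measurable_fun setT g -> (forall l, `|g l| <= C) ->
  leb.-integrable setT (EFin \o (fun l => g l * expR (- (s * l ^+ (2 * k))))).
Proof.
move=> k0 s0 mg gC; apply: (@integrable_heat_exp k s 0 C) => // l.
by rewrite mulr0 normr0 expR0 mulr1.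
Qed.

Lemma powX_le_expR (j : nat) (y : R) : 0 <= y -> y ^+ j <= (j`!)%:R * expR y.
Proof.
move=> y0; case: j => [|j].
  by rewrite expr0 fact0 mul1r -expR0 ler_expR.
have j0 : 0 < (j.+1`!)%:R :> R by rewrite ltr0n fact_gt0.
rewrite -ler_pdivrMl// mulrC (le_trans _ (expR_ge1Dxn j y0))// lerDr//.
Qed.

Lemma integrable_heat_moment (k j : nat) (s : R) : (0 < k)%N -> 0 < s ->
  leb.-integrable setT (EFin \o (fun l => l ^+ j * expR (- (s * l ^+ (2 * k))))).
Proof.
move=> k0 s0; apply: (@integrable_heat_exp k s 1 (j`!)%:R) => // l.
by rewrite mulr1 normrX powX_le_expR.
Qed.

End gaussian_domination.

(** * Gamma values as moments of [exp (- s x ^ p)] *)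

Section gamma_moments.
Context {R : realType}.
Notation leb := (@lebesgue_measure R).

Lemma continuous_powR (a : R) : {in `]0%R, +oo[, continuous (fun y : R => y `^ a)}.
Proof.
move=> y y0; apply: differentiable_continuous; apply/derivable1_diffP.
exact: derivable_powR.
Qed.

(** Substituting [y = s x ^ p], the Jacobian [x ^ (p - 1)] and the power of [y] combine to [x ^ j].
    The equality is between extended reals because it also serves to prove finiteness in
    [integrable_power_singularity]. *)
Lemma gamma_integral_moment (s : R) (p j : nat) : 0 < s -> (0 < p)%N ->
  (\int[leb]_(y in `]0%R, +oo[) (y `^ (j.+1%:R / p%:R - 1) * expR (- y))%:E =
   (p%:R * s `^ (j.+1%:R / p%:R))%:E *
     \int[leb]_(x in `]0%R, +oo[) (x ^+ j * expR (- (s * x ^+ p)))%:E)%E.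
Proof.
move=> s0 p0; set a : R := j.+1%:R / p%:R.
have p0R : p%:R != 0 :> R by rewrite pnatr_eq0 -lt0n.
rewrite (@ge0_integral_power R s p)//; last 2 first.
- move=> y y0; apply: cvgM; first exact: continuous_powR.
  by apply: continuous_comp; [exact: oppr_continuous|exact: continuous_expR].
- by move=> y _; rewrite mulr_ge0 ?powR_ge0 ?expR_ge0.
rewrite -ge0_integralZl//=.
- apply: eq_integral => x; rewrite inE/= in_itv/= andbT => x0.
  rewrite -EFinM; congr EFin.
  have xp0 : 0 < x ^+ p by rewrite exprn_gt0.
  have -> : s `^ a = s * s `^ (a - 1).
    by rewrite mulr_powRB1// ?ltW// divr_gt0 ?ltr0n.
  rewrite powRM ?ltW//.
  suff -> : x ^+ j = (x ^+ p) `^ (a - 1) * x ^+ p.-1 by ring.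
  rewrite -(powR_mulrn p (ltW x0)) -powRrM -(powR_mulrn p.-1 (ltW x0)) -powRD; last first.
    by apply/implyP => _; rewrite gt_eqF.
  rewrite -(powR_mulrn j (ltW x0)); congr powR.
  have -> : p.-1%:R = p%:R - 1 :> R by rewrite -subn1 natrB.
  by rewrite /a -natr1; field.
- apply/measurable_EFinP; apply: measurable_funTS; apply: measurable_funM => //.
  exact: measurable_expR_power.
- by move=> x; rewrite in_itv/= andbT => x0; rewrite lee_fin mulr_ge0 ?expR_ge0// exprn_ge0// ltW.
- by rewrite lee_fin mulr_ge0 ?powR_ge0.
Qed.

(** Even powers make the whole-line moment twice the half-line one. The lemma is used with order
    [2 * k] for the numerators of the Fox-Wright terms and with [k = 1] for the denominators. *)
Lemma GammaR_moment (s : R) (k n : nat) : 0 < s -> (0 < k)%N ->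
  GammaR ((2 * n).+1%:R / (2 * k)%:R) =
  (2 * k)%:R * s `^ ((2 * n).+1%:R / (2 * k)%:R) / 2 *
     \int[leb]_x (x ^+ (2 * n) * expR (- (s * x ^+ (2 * k)))).
Proof.
move=> s0 k0; rewrite /GammaR /Rintegral (gamma_integral_moment (2 * n) s0) ?muln_gt0//.
set J := (\int[leb]_(x in _) _)%E.
have E : (\int[leb]_x (x ^+ (2 * n) * expR (- (s * x ^+ (2 * k))))%:E = 2%:E * J)%E.
  apply: ge0_integral_even.
  - apply/measurable_EFinP; apply: measurable_funM => //; exact: measurable_expR_power.
  - by move=> x; rewrite lee_fin mulr_ge0 ?expR_ge0// exprM exprn_ge0// sqr_ge0.
  - by move=> x; rewrite !exprM sqrrN.
have Jfin : J \is a fin_num.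
  apply: integrable_fin_num => //.
  exact: integrableS (integrable_heat_moment (2 * n) k0 s0).
by rewrite /Rintegral E !fineM//=; field.
Qed.

Lemma is_derive_gauss_power (n : nat) (x : R) :
  is_derive x 1 (fun y : R => - (y ^+ (2 * n).+1 * expR (- y ^+ 2)))
    (2 * (x ^+ (2 * n.+1) * expR (- x ^+ 2)) -
     (2 * n).+1%:R * (x ^+ (2 * n) * expR (- x ^+ 2))).
Proof.
have -> : (fun y : R => - (y ^+ (2 * n).+1 * expR (- y ^+ 2))) =
  - ((@id R) ^+ (2 * n).+1 * (expR \o (- (@id R) ^+ 2))).
  by apply/funext => y; rewrite /= !fctE.
apply: is_derive_eq.
rewrite /GRing.scale/= !fctE /= expr1 !mulr1 mulnS !exprS; ring.
Qed.

(** With [N = n + 1], the bounds [N ^ (j + 1) <= (j + 1)! exp N] and [exp (N - N ^ 2) <= 1] show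
    that the term is at most [(j + 1)! / N]. *)
Lemma gauss_power_cvg0 (j : nat) :
  (n.+1%:R ^+ j * expR (- n.+1%:R ^+ 2) : R) @[n --> \oo] --> 0.
Proof.
apply/cvgr0Pnorm_le => e e0.
have := @cvg_harmonic R => /cvgr0Pnorm_le /(_ (e / (j.+1`!)%:R)).
have f0 : 0 < (j.+1`!)%:R :> R by rewrite ltr0n fact_gt0.
move=> /(_ (divr_gt0 e0 f0)); apply: filterS => n /=.
rewrite ger0_norm ?invr_ge0// ler_pdivlMr// => he.
rewrite ger0_norm ?mulr_ge0 ?expR_ge0 ?exprn_ge0//; apply: le_trans he.
set N : R := n.+1%:R; have N0 : 0 < N by [].
have N1 : 1 <= N by rewrite ler1n.
rewrite [leRHS]mulrC ler_pdivlMr// mulrAC -exprSr.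
rewrite (le_trans (ler_wpM2r (expR_ge0 _) (powX_le_expR j.+1 (ltW N0))))//.
rewrite -mulrA -expRD ler_piMr// ?ler0n// expR_le1 subr_le0 expr2 ler_peMr// ltW.
Qed.

(** Integration by parts on [[- N, N]], then [N] to infinity. The exponent [1 * x ^ (2 * 1)] is the
    heat exponent at [s = k = 1], the form in which [GammaR_moment] delivers it. *)
Lemma gauss_moment_rec (n : nat) :
  2 * \int[leb]_x (x ^+ (2 * n.+1) * expR (- (1 * x ^+ (2 * 1)))) =
  (2 * n).+1%:R * \int[leb]_x (x ^+ (2 * n) * expR (- (1 * x ^+ (2 * 1)))) :> R.
Proof.
pose g i (x : R) := x ^+ (2 * i) * expR (- x ^+ 2).
have gE i : \int[leb]_x (x ^+ (2 * i) * expR (- (1 * x ^+ (2 * 1)))) = \int[leb]_x g i x.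
  by apply: eq_Rintegral => x _; rewrite mul1r muln1.
rewrite !gE.
have ig i : leb.-integrable setT (EFin \o g i).
  have := @integrable_heat_moment R 1 (2 * i) 1 isT ltr01.
  by apply: eq_integrable => // x _ /=; rewrite mul1r muln1.
have g0 i x : 0 <= g i x by rewrite mulr_ge0 ?expR_ge0// exprM exprn_ge0// sqr_ge0.
have cg i : continuous (g i).
  move=> x; apply: cvgM; first exact: exprn_continuous.
  apply: continuous_comp; last exact: continuous_expR.
  by apply: cvgN; exact: exprn_continuous.
have mg i : measurable_fun setT (g i) by exact: continuous_measurable_fun.
have igN i (N : nat) : leb.-integrable `[- N.+1%:R, N.+1%:R]%classic (EFin \o g i).
  by apply: integrableS (ig i).
pose S i (N : nat) := \int[leb]_(x in `[- N.+1%:R, N.+1%:R]) g i x.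
have cS i : S i N @[N --> \oo] --> \int[leb]_x g i x.
  rewrite /S /Rintegral; apply: fine_cvg; rewrite fineK; last exact: integrable_fin_num (ig i).
  have -> : [set: R] = \bigcup_N `[- N.+1%:R, N.+1%:R]%classic.
    apply/seteqP; split => // x _; exists (Num.bound `|x|) => //=.
    rewrite in_itv/= -ler_norml ltW// (lt_le_trans (archi_boundP _))// ?ler_nat//.
  apply: ge0_nondecreasing_set_cvg_integral => //.
  - move=> a b ab; apply/subsetPset => x /=; rewrite !in_itv/= -!ler_norml => /le_trans; apply.
    by rewrite ler_nat ltnS.
  - by move=> N; apply/measurable_EFinP; exact: measurable_funS (mg i).
  - by move=> N x _; rewrite lee_fin.
pose F := fun y : R => - (y ^+ (2 * n).+1 * expR (- y ^+ 2)).
have FTC N : 2 * S n.+1 N - (2 * n).+1%:R * S n N = F N.+1%:R - F (- N.+1%:R).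
  rewrite /S -!RintegralZl// -RintegralB//; last 2 first.
  - by have := @integrableZl _ _ _ leb _ _ 2 _ (igN n.+1 N); exact.
  - by have := @integrableZl _ _ _ leb _ _ (2 * n).+1%:R _ (igN n N); exact.
  rewrite /Rintegral (@continuous_FTC2 _ _ F)//=.
  - by rewrite gtrN.
  - apply: continuous_subspaceT => x; apply: cvgB; apply: cvgM; (try exact: cvg_cst); exact: cg.
  - split.
    + by move=> x _; have [] := is_derive_gauss_power n x.
    + apply: cvg_at_right_filter; apply: differentiable_continuous; apply/derivable1_diffP.
      by have [] := is_derive_gauss_power n (- N.+1%:R).
    + apply: cvg_at_left_filter; apply: differentiable_continuous; apply/derivable1_diffP.
      by have [] := is_derive_gauss_power n N.+1%:R.
  - move=> x _; rewrite derive1E; by have [_ ->] := is_derive_gauss_power n x.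
have cF : (F N.+1%:R - F (- N.+1%:R)) @[N --> \oo] --> (0 : R).
  have -> : (fun N : nat => F N.+1%:R - F (- N.+1%:R)) =
     (fun N => (- 2) * (N.+1%:R ^+ (2 * n).+1 * expR (- N.+1%:R ^+ 2))).
    (* [F] is odd, so the two boundary terms add up instead of cancelling; each tends to 0. *)
    apply/funext => N; rewrite /F sqrrN exprNn -signr_odd /= oddM/= expr1; ring.
  rewrite -[X in _ --> X](mulr0 (-2)); apply: cvgM; first exact: cvg_cst.
  exact: gauss_power_cvg0.
have cD : (2 * S n.+1 N - (2 * n).+1%:R * S n N) @[N --> \oo] -->
   2 * \int[leb]_x g n.+1 x - (2 * n).+1%:R * \int[leb]_x g n x.
  by apply: cvgB; apply: cvgM; (try exact: cvg_cst); exact: cS.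
apply/eqP; rewrite -subr_eq0; apply/eqP.
move: cD; under eq_fun do rewrite FTC.
by move=> cD; exact: (cvg_unique _ cD cF).
Qed.

Lemma gauss_moment (n : nat) :
  \int[leb]_x (x ^+ (2 * n) * expR (- (1 * x ^+ (2 * 1)))) =
  ((2 * n)`!)%:R * Num.sqrt pi / (4 ^+ n * (n`!)%:R) :> R.
Proof.
elim: n => [|n IH].
  rewrite muln0 fact0 expr0 !mul1r divr1.
  under eq_Rintegral do rewrite expr0 !mul1r muln1.
  by rewrite /Rintegral (@integralT_gauss R).
apply: (@mulfI _ 2); first by rewrite pnatr_eq0.
rewrite gauss_moment_rec IH.
rewrite mulnS !factS exprS !natrM.
have n0 : (n`!)%:R != 0 :> R by rewrite pnatr_eq0 -lt0n fact_gt0.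
have n1 : n.+1%:R != 0 :> R by rewrite pnatr_eq0.
have e4 : 4 ^+ n != 0 :> R by rewrite expf_neq0// pnatr_eq0.
have -> : (2 * n).+2%:R = 2 * n.+1%:R :> R by rewrite -natrM mulnS.
move: (n`!)%:R n0 n.+1%:R n1 (4 ^+ n) e4 => u u0 v v0 w w0.
by field; rewrite w0 u0 v0.
Qed.

(** Multiplied by [n!], this value is [(2n)! / 4 ^ n] up to [sqrt pi], which is how the cosine
    coefficients come out of the Fox-Wright denominators. *)
Lemma GammaR_half (n : nat) :
  GammaR (1 / 2 + 1 * n%:R) = ((2 * n)`!)%:R * Num.sqrt pi / (4 ^+ n * (n`!)%:R) :> R.
Proof.
have -> : 1 / 2 + 1 * n%:R = (2 * n).+1%:R / (2 * 1)%:R :> R.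
  have -> : (2 * n).+1%:R = 2 * n%:R + 1 :> R by rewrite -natr1 natrM.
  by rewrite muln1; field.
rewrite (@GammaR_moment 1 1 n)// gauss_moment powR1 muln1; field.
by rewrite pnatr_eq0 -lt0n fact_gt0 expf_neq0// pnatr_eq0.
Qed.

End gamma_moments.

(** * The cosine transform of the heat factor as a Fox-Wright series *)

Section fox_wright.
Context {R : realType}.
Notation leb := (@lebesgue_measure R).

(** In absolute value the cosine terms are the even-index terms of the exponential series. The bound
    is uniform in [N] and provides the dominating function for termwise integration. *)
Lemma series_cos_coeff'_le (y : R) (N : nat) :
  `|series (cos_coeff' y) N| <= expR `|y|.
Proof.
have nd : nondecreasing_seq (series (exp_coeff `|y|)).
  by apply: nondecreasing_series => n _ _; rewrite divr_ge0// exprn_ge0.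
apply: (@le_trans _ _ (series (exp_coeff `|y|) (2 * N)%N)); last first.
  exact: nondecreasing_cvgn_le nd (is_cvg_series_exp_coeff _) _.
elim: N => [|N IH].
  by rewrite /series/= muln0 !big_geq// normr0.
rewrite mulnS !seriesSr (le_trans (ler_normD _ _))// -addrA lerD//.
have -> : `|cos_coeff' y N| = exp_coeff `|y| (2 * N)%N.
  rewrite /cos_coeff' /exp_coeff/= !normrM normfV normr_nat normrX -mul2n.
  by rewrite normrN1 expr1n mul1r normrX.
by rewrite lerDl divr_ge0// exprn_ge0.
Qed.

Lemma cvg_series_heat_moment (k : nat) (s x : R) : (0 < k)%N -> 0 < s ->
  series (fun n : nat => (-1) ^+ n * x ^+ (2 * n) / ((2 * n)`!)%:R *
    \int[leb]_l (l ^+ (2 * n) * expR (- (s * l ^+ (2 * k))))) @ \oo -->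
  \int[leb]_l (cos (l * x) * expR (- (s * l ^+ (2 * k)))).
Proof.
move=> k0 s0.
pose E l : R := expR (- (s * l ^+ (2 * k))).
have mE : measurable_fun setT E by exact: measurable_expR_power.
pose g N l := series (cos_coeff' (l * x)) N * E l.
have gE N l : g N l = \sum_(0 <= n < N)
    ((-1) ^+ n * x ^+ (2 * n) / ((2 * n)`!)%:R) * (l ^+ (2 * n) * E l).
  rewrite /g /series/= mulr_suml; apply: eq_bigr => n _.
  rewrite /cos_coeff' -mul2n -exprnP exprMn; ring.
have im n : leb.-integrable setT (EFin \o (fun l => l ^+ (2 * n) * E l)).
  exact: integrable_heat_moment.
have imZ n (c : R) : leb.-integrable setT (EFin \o (fun l => c * (l ^+ (2 * n) * E l))).
  by have := @integrableZl _ _ _ leb setT measurableT c _ (im n).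
have mg N : measurable_fun setT (g N).
  rewrite (_ : g N = (fun l => \sum_(0 <= n < N)
    ((-1) ^+ n * x ^+ (2 * n) / ((2 * n)`!)%:R) * (l ^+ (2 * n) * E l))); last first.
    by apply/funext => l; rewrite gE.
  apply: measurable_sum => n; apply: measurable_funM => //.
  exact: measurable_funM.
have sumE N : \int[leb]_l g N l = \sum_(0 <= n < N)
    ((-1) ^+ n * x ^+ (2 * n) / ((2 * n)`!)%:R) * \int[leb]_l (l ^+ (2 * n) * E l).
  under eq_Rintegral do rewrite gE.
  elim: N => [|N IH].
    by under eq_Rintegral do rewrite big_geq//; rewrite Rintegral_cst// mul0r big_geq.
  under eq_Rintegral do rewrite big_nat_recr//=.
  rewrite big_nat_recr//= RintegralD//; last first.
    apply: (@eq_integrable _ _ _ leb setT measurableT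
       (fun l => \sum_(0 <= n < N) ((((-1) ^+ n * x ^+ (2 * n) / ((2 * n)`!)%:R)
          * (l ^+ (2 * n) * E l))%:E))%E).
      by move=> l _; rewrite /= sumEFin.
    by apply: integrable_sum => // n _; exact: imZ.
  by rewrite IH RintegralZl.
have -> : series (fun n : nat => (-1) ^+ n * x ^+ (2 * n) / ((2 * n)`!)%:R *
    \int[leb]_l (l ^+ (2 * n) * expR (- (s * l ^+ (2 * k))))) = (fun N => \int[leb]_l g N l).
  by apply/funext => N; rewrite sumE.
have ib : leb.-integrable setT (EFin \o (fun l => expR `|l * x| * E l)).
  apply: (@integrable_heat_exp R k s x 1) => //.
    apply: measurableT_comp => //; apply: measurableT_comp => //.
    exact: measurable_funM.
  by move=> l; rewrite mul1r ger0_norm ?expR_ge0.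
have ic : leb.-integrable setT (EFin \o (fun l => cos (l * x) * E l)).
  apply: (@integrable_heat_bounded R k s 1) => //.
    apply: measurableT_comp; last exact: measurable_funM.
    by apply: continuous_measurable_fun; exact: continuous_cos.
  by move=> l; exact: cos_max.
rewrite /Rintegral; apply: fine_cvg; rewrite fineK; last exact: integrable_fin_num ic.
apply: (@dominated_cvg _ _ _ leb setT measurableT
  (fun N l => (g N l)%:E) _ (EFin \o (fun l => expR `|l * x| * E l))) => //=.
- by move=> N; apply/measurable_EFinP; exact: mg.
- move=> l _; apply: cvg_EFin; first exact: nearW.
  by apply: cvgM; [exact: cvg_cos_coeff'|exact: cvg_cst].
- move=> N l _; rewrite lee_fin normrM [`|E l|]ger0_norm ?expR_ge0//.
  by rewrite ler_wpM2r ?expR_ge0// series_cos_coeff'_le.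
Qed.

Lemma Rintegral_cos_heat (k : nat) (s x : R) : (0 < k)%N -> 0 < s ->
  \int[leb]_l (cos (l * x) * expR (- (s * l ^+ (2 * k)))) =
  2 * Num.sqrt pi / ((2 * k)%:R * s `^ ((2 * k)%:R^-1)) *
  FoxWright11 ((2 * k)%:R^-1) (2 / (2 * k)%:R) (1 / 2) 1
    (- (x ^+ 2 / (4 * s `^ (2 / (2 * k)%:R)))).
Proof.
move=> k0 s0; set m := (2 * k)%N; have m0 : (0 < m)%N by rewrite muln_gt0.
have mR : m%:R != 0 :> R by rewrite pnatr_eq0 -lt0n.
set c := (X in _ = X * _).
have sp0 : 0 < s `^ m%:R^-1 by rewrite powR_gt0.
have spi : 0 < Num.sqrt pi :> R by rewrite sqrtr_gt0 pi_gt0.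
have c0 : c != 0.
  by rewrite mulf_neq0 ?invr_eq0 ?mulf_neq0 ?gt_eqF// ltr0n.
rewrite /FoxWright11; set t := (fun n : nat => _).
(* The numerator supplies [m s ^ (1/m) s ^ (2n/m) / 2] times the moment. Its power [s ^ (2n/m)]
   cancels that of the argument, and [4 ^ n] cancels against [Gamma (1/2 + n)]; the factor left over
   is [c^-1]. *)
have tE n : t n = c^-1 * ((-1) ^+ n * x ^+ (2 * n) / ((2 * n)`!)%:R *
    \int[leb]_l (l ^+ (2 * n) * expR (- (s * l ^+ (2 * k))))).
  have n21 : (2 * n).+1%:R = 2 * n%:R + 1 :> R by rewrite -natr1 natrM.
  have sn : s `^ ((2 * n).+1%:R / m%:R) = s `^ m%:R^-1 * (s `^ (2 / m%:R)) ^+ n.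
    rewrite -powR_mulrn ?powR_ge0// -powRrM -powRD; last first.
      by apply/implyP => _; rewrite gt_eqF.
    by congr powR; rewrite n21; field.
  have s2 : 0 < s `^ (2 / m%:R) by rewrite powR_gt0.
  rewrite /t GammaR_half.
  have -> : m%:R^-1 + 2 / m%:R * n%:R = (2 * n).+1%:R / m%:R :> R.
    by rewrite n21; field.
  rewrite (GammaR_moment n s0 k0) sn; set J := Rintegral _ _ _.
  have -> : (- (x ^+ 2 / (4 * s `^ (2 / m%:R)))) ^+ n =
      (-1) ^+ n * x ^+ (2 * n) / (4 ^+ n * (s `^ (2 / m%:R)) ^+ n).
    by rewrite [LHS]exprNn expr_div_n -exprM exprMn mulrA.
  rewrite /c -/m.
  have f1 : (n`!)%:R != 0 :> R by rewrite pnatr_eq0 -lt0n fact_gt0.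
  have f2 : ((2 * n)`!)%:R != 0 :> R by rewrite pnatr_eq0 -lt0n fact_gt0.
  have f3 : 4 ^+ n != 0 :> R by rewrite expf_neq0// pnatr_eq0.
  have f4 : (s `^ (2 / m%:R)) ^+ n != 0 by rewrite expf_neq0// gt_eqF.
  have f5 : s `^ m%:R^-1 != 0 by rewrite gt_eqF.
  have f6 : Num.sqrt pi != 0 :> R by rewrite gt_eqF.
  move: ((s `^ (2 / m%:R)) ^+ n) f4 (s `^ m%:R^-1) f5 => a4 ? a5 ?.
  move: (n`!)%:R f1 ((2 * n)`!)%:R f2 (4 ^+ n) f3 (Num.sqrt pi) f6 m%:R mR.
  move=> a1 ? a2 ? a3 ? a6 ? a9 ?.
  by field; do ?[apply/andP; split => //].
have := @cvg_series_heat_moment k s x k0 s0; set u := (fun n : nat => _) => cu.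
have -> : series t = c^-1 \*o series u.
  apply/funext => N; rewrite /series/= mulr_sumr; apply: eq_bigr => n _; exact: tE.
have -> : limn (c^-1 \*o series u) = c^-1 * \int[leb]_l (cos (l * x) * expR (- (s * l ^+ m))).
  by apply/cvg_lim => //; apply: cvgM => //; exact: cvg_cst.
by rewrite mulrA divff// mul1r.
Qed.

End fox_wright.

(** * Bounds, continuity and integrability of the Bessel terms *)

Section bessel.
Context {R : realType}.
Notation leb := (@lebesgue_measure R).

Lemma coshR_gt0 (s : R) : 0 < coshR s.
Proof. by rewrite divr_gt0// addr_gt0// expR_gt0. Qed.

Lemma coshR_ge_half (s : R) : expR s / 2 <= coshR s.
Proof. by rewrite /coshR ler_pM2r// lerDl expR_ge0. Qed.

Lemma coshR_le (nu s : R) : 0 <= s -> coshR (nu * s) <= expR (`|nu| * s).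
Proof.
move=> s0; rewrite /coshR ler_pdivrMr// mulr_natr mulr2n lerD// ler_expR.
  by rewrite ler_wpM2r// ler_norm.
by rewrite -mulNr ler_wpM2r// -normrN ler_norm.
Qed.

Lemma continuous_coshR : continuous (@coshR R).
Proof.
move=> s; apply: cvgM; last exact: cvg_cst.
apply: cvgD; first exact: continuous_expR.
by apply: continuous_comp; [exact: oppr_continuous|exact: continuous_expR].
Qed.

Lemma measurable_bessel_integrand (nu z : R) :
  measurable_fun setT (fun s : R => expR (- (z * coshR s)) * coshR (nu * s)).
Proof.
have mc : measurable_fun setT (@coshR R).
  exact: continuous_measurable_fun continuous_coshR.
apply: measurable_funM.
  apply: measurableT_comp => //; apply: measurableT_comp => //.
  exact: measurable_funM.
by apply: measurableT_comp => //; exact: measurable_funM.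
Qed.

Lemma bessel_integrand_ge0 (nu z s : R) : 0 <= expR (- (z * coshR s)) * coshR (nu * s).
Proof. by rewrite mulr_ge0 ?expR_ge0// ltW// coshR_gt0. Qed.

(* From [exp (- y) <= y ^ (-1/2)] applied to [y = z exp s / 2]. *)
Lemma bessel_integrand_le (nu z s : R) : 0 < z -> 0 <= s ->
  expR (- (z * coshR s)) * coshR (nu * s) <=
  expR (ln 2 / 2) * z `^ (- 2^-1) * expR (- ((2^-1 - `|nu|) * s)).
Proof.
move=> z0 s0.
set y := z * (expR s / 2).
have y0 : 0 < y by rewrite mulr_gt0// divr_gt0// expR_gt0.
have lny : ln y = ln z + s - ln 2.
  by rewrite lnM ?posrE ?divr_gt0 ?expR_gt0// ln_div ?posrE ?expR_gt0// expRK addrA.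
have e1 : expR (- (z * coshR s)) <= expR (- (ln y / 2)).
  rewrite ler_expR lerN2.
  have := ler_wpM2l (ltW z0) (coshR_ge_half s); rewrite -/y.
  have := ln_sublinear y0; lra.
rewrite (le_trans (ler_pM _ _ e1 (@coshR_le nu s s0)))//.
  exact/ltW/coshR_gt0.
rewrite /powR gt_eqF// -!expRD ler_expR lny; lra.
Qed.

Lemma integrable_expRN (c : R) : 0 < c ->
  leb.-integrable `[0%R, +oo[ (EFin \o (fun s : R => expR (- (c * s)))).
Proof.
move=> c0.
have ip := integrable_exponential_pdf c0.
have : leb.-integrable `[0%R, +oo[ (EFin \o exponential_pdf c) by exact: integrableS ip.
move=> /(@integrableZl _ _ _ leb _ (measurable_itv _) c^-1).
apply: eq_integrable => // s; rewrite inE/= => s0.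
rewrite /exponential_pdf patchE mem_set// -EFinM; congr EFin.
by rewrite mulrA mulVf ?mul1r ?mulNr// gt_eqF.
Qed.

(** The bound [bessel_integrand_le] decays in [s] at rate [1/2 - |nu|], hence the condition on [nu].
    The orders [(kap - 1) / 2] satisfy it. *)
Lemma integrable_bessel (nu z : R) : `|nu| < 2^-1 -> 0 < z ->
  leb.-integrable `[0%R, +oo[
    (EFin \o (fun s => expR (- (z * coshR s)) * coshR (nu * s))).
Proof.
move=> nu12 z0; have c0 : 0 < 2^-1 - `|nu| by rewrite subr_gt0.
have := @integrableZl _ _ _ leb _ (measurable_itv _)
  (expR (ln 2 / 2) * z `^ (- 2^-1)) _ (integrable_expRN c0).
apply: le_integrable => //.
  by apply/measurable_EFinP/measurable_funTS; exact: measurable_bessel_integrand.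
move=> s /=; rewrite in_itv/= andbT => s0.
rewrite lee_fin ger0_norm ?bessel_integrand_ge0//.
by rewrite (le_trans (bessel_integrand_le nu z0 s0))// ler_norm.
Qed.

Lemma BesselK_ge0 (nu z : R) : 0 <= BesselK nu z.
Proof. by apply: Rintegral_ge0 => s _; exact: bessel_integrand_ge0. Qed.

(** The exponent -1/2 is cruder than the true [- |nu|], but sufficient: after division by
    [z ^ ((1 - kap) / 2)] the singularity has exponent [kap / 2 - 1], still above -1. *)
Lemma BesselK_le (nu : R) : `|nu| < 2^-1 ->
  exists2 A : R, 0 <= A & forall z, 0 < z -> BesselK nu z <= A * z `^ (- 2^-1).
Proof.
move=> nu12; have c0 : 0 < 2^-1 - `|nu| by rewrite subr_gt0.
have ie := integrable_expRN c0.
exists (expR (ln 2 / 2) * \int[leb]_(s in `[0%R, +oo[) expR (- ((2^-1 - `|nu|) * s))).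
  by rewrite mulr_ge0 ?expR_ge0// Rintegral_ge0// => s _; exact: expR_ge0.
move=> z z0; rewrite mulrAC -RintegralZl//.
apply: le_Rintegral => //.
- exact: integrable_bessel.
- by have := @integrableZl _ _ _ leb _ (measurable_itv _)
    (expR (ln 2 / 2) * z `^ (- 2^-1)) _ ie.
- move=> s /=; rewrite in_itv/= andbT => s0; exact: bessel_integrand_le.
Qed.

(** The integrand decreases in its first parameter, so on []z / 2, 2 z[] it is dominated by its
    value at [z / 2]. *)
Lemma continuous_BesselK (nu z : R) : `|nu| < 2^-1 -> 0 < z ->
  {for z, continuous (BesselK nu)}.
Proof.
move=> nu12 z0; have z20 : 0 < z / 2 by rewrite divr_gt0.
have zin : z \in (`]z / 2, 2 * z[%classic : set R).
  by rewrite inE/= in_itv/=; apply/andP; split; lra.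
apply: (@continuity_under_integral R _ _ leb
  (fun x s => expR (- (x * coshR s)) * coshR (nu * s)) `[0%R, +oo[ _
  (z / 2) (2 * z) _ _ (fun s => expR (- (z / 2 * coshR s)) * coshR (nu * s))) => //.
- move=> x /=; rewrite in_itv/= => /andP[xz _]; apply: integrable_bessel => //.
  exact: lt_trans xz.
- apply: aeW => s _ x _; apply: cvgM; last exact: cvg_cst.
  apply: continuous_comp; last exact: continuous_expR.
  by apply: cvgN; apply: cvgM; [exact: cvg_id|exact: cvg_cst].
- exact: integrable_bessel.
- move=> x /=; rewrite in_itv/= => /andP[xz _]; apply: aeW => s _.
  rewrite ger0_norm ?bessel_integrand_ge0// ler_pM2r ?coshR_gt0//.
  by rewrite ler_expR lerN2 ler_pM2r ?coshR_gt0// ltW.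
Qed.

(** Up to the factor [c1 kap], this is the spectral density of the covariance
    [(1 + x ^ 2) ^ (- kap / 2)]; the cosine factors of Assumption B translate it by [w j] and
    [- w j]. *)
Definition bessel_term (kap z : R) : R :=
  BesselK ((kap - 1) / 2) `|z| / `|z| `^ ((1 - kap) / 2).

Lemma norm_bessel_order (kap : R) : 0 < kap < 1 -> `|(kap - 1) / 2| = (1 - kap) / 2.
Proof. by move=> /andP[k0 k1]; rewrite ltr0_norm; lra. Qed.

Lemma bessel_order_lt (kap : R) : 0 < kap < 1 -> `|(kap - 1) / 2| < 2^-1.
Proof. by move=> k01; rewrite norm_bessel_order//; move/andP : k01 => [k0 k1]; lra. Qed.

Lemma bessel_termN (kap z : R) : bessel_term kap (- z) = bessel_term kap z.
Proof. by rewrite /bessel_term normrN. Qed.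

Lemma bessel_term_ge0 (kap z : R) : 0 <= bessel_term kap z.
Proof. by rewrite divr_ge0 ?BesselK_ge0 ?powR_ge0. Qed.

Lemma continuous_bessel_term (kap z : R) : 0 < kap < 1 -> z != 0 ->
  {for z, continuous (bessel_term kap)}.
Proof.
move=> k01 z0; have az : 0 < `|z| by rewrite normr_gt0.
apply: cvgM.
  apply: continuous_comp; first exact: norm_continuous.
  by apply: continuous_BesselK => //; exact: bessel_order_lt.
apply: cvgV; first by rewrite gt_eqF// powR_gt0.
apply: (@continuous_comp _ _ _ (fun x : R => `|x|) (fun y => y `^ ((1 - kap) / 2))).
  exact: norm_continuous.
by apply: continuous_powR; rewrite in_itv/= andbT.
Qed.

Lemma measurable_bessel_term (kap : R) : 0 < kap < 1 ->
  measurable_fun setT (bessel_term kap).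
Proof.
move=> k01; rewrite -(setvU [set 0 : R]); apply/measurable_funU => //.
  exact: measurableC.
split; last exact: measurable_fun_set1.
apply: open_continuous_measurable_fun.
  exact/closed_openC/closed_eq.
by move=> z; rewrite inE/= => /eqP z0; exact: continuous_bessel_term.
Qed.

Lemma bessel_term_le (kap : R) : 0 < kap < 1 ->
  exists2 A : R, 0 <= A & forall z, bessel_term kap z <= A * `|z| `^ (kap / 2 - 1).
Proof.
move=> k01; have [A A0 hA] := BesselK_le (bessel_order_lt k01).
exists A => // z; have /andP[k0 k1] := k01.
have [->|z0] := eqVneq z 0.
  (* At 0 the denominator is 0, and division by 0 gives 0. *)
  rewrite /bessel_term normr0 powR0 ?invr0 ?mulr0; last by lra.
  by rewrite mulr_ge0 ?powR_ge0.
have az : 0 < `|z| by rewrite normr_gt0.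
rewrite /bessel_term ler_pdivrMr ?powR_gt0// (le_trans (hA _ az))//.
rewrite -mulrA ler_wpM2l// -powRD; last by rewrite normr_eq0 z0 implybT.
by rewrite le_eqVlt; apply/orP; left; apply/eqP; congr powR; field.
Qed.

(* Comparison with the integrable function [|z| ^ (1/p - 1) exp (- |z|)], where
   [p] is even and [1/p <= a]. *)
Lemma power_singularity_le (a : R) (p : nat) (z : R) : (0 < p)%N -> p%:R^-1 <= a -> a < 1 ->
  `|z| `^ (a - 1) <= 1 + expR 1 * (`|z| `^ (p%:R^-1 - 1) * expR (- `|z|)).
Proof.
move=> p0 pa a1.
have h0 : 0 <= expR 1 * (`|z| `^ (p%:R^-1 - 1) * expR (- `|z|)).
  by rewrite !mulr_ge0 ?expR_ge0 ?powR_ge0.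
have [->|z0] := eqVneq z 0.
  by rewrite {1}normr0 powR0; [rewrite addr_ge0//|rewrite subr_eq0 lt_eqF].
have az : 0 < `|z| by rewrite normr_gt0.
have [z1|z1] := leP 1 `|z|.
  rewrite (@le_trans _ _ 1)// ?lerDl// -[leRHS](powRr0 `|z|) ler_powR//.
  by rewrite subr_le0 ltW.
rewrite (@le_trans _ _ (`|z| `^ (p%:R^-1 - 1)))//.
  by apply: ger_powR; rewrite ?az ?(ltW z1)// lerD2r.
rewrite mulrCA -expRD ler_wpDl// ler_peMr ?powR_ge0//.
by rewrite -[leLHS]expR0 ler_expR subr_ge0 ltW.
Qed.

(** The integral is twice [Gamma (1/p)] with [p = 2 * k]. Substituting [y = x ^ p] turns it into a
    heat moment of order [p], which is why the exponents are tied to reciprocals of even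
    integers. *)
Lemma integrable_power_singularity (k : nat) : (0 < k)%N ->
  leb.-integrable setT
    (EFin \o (fun z : R => `|z| `^ ((2 * k)%:R^-1 - 1) * expR (- `|z|))).
Proof.
move=> k0; set p := (2 * k)%N.
have m1 : measurable_fun setT (fun z : R => `|z| `^ (p%:R^-1 - 1) * expR (- `|z|)).
  apply: measurable_funM.
    by apply: (@measurableT_comp _ _ _ _ _ _ (fun y : R => y `^ (p%:R^-1 - 1)));
      [exact: measurable_powR|exact: normr_measurable].
  by apply: measurableT_comp => //; apply: measurableT_comp.
have g0 (z : R) : 0 <= `|z| `^ (p%:R^-1 - 1) * expR (- `|z|).
  by rewrite mulr_ge0 ?powR_ge0 ?expR_ge0.
apply/integrableP; split; first exact/measurable_EFinP.
under eq_integral do rewrite /= ger0_norm//.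
rewrite ge0_integral_even; last 3 first.
- exact/measurable_EFinP.
- by move=> z; rewrite lee_fin.
- by move=> z; rewrite normrN.
have -> : (\int[leb]_(x in `]0%R, +oo[) (`|x| `^ (p%:R^-1 - 1) * expR (- `|x|))%:E =
    \int[leb]_(x in `]0%R, +oo[) (x `^ (1%:R / p%:R - 1) * expR (- x))%:E)%E.
  by apply: eq_integral => x; rewrite inE/= in_itv/= andbT => x0; rewrite gtr0_norm// div1r.
rewrite (gamma_integral_moment 0 ltr01) ?muln_gt0//.
rewrite -ge0_fin_numE; last first.
  rewrite mule_ge0// mule_ge0 ?lee_fin ?mulr_ge0 ?powR_ge0//.
  by apply: integral_ge0 => x _; rewrite lee_fin mulr_ge0// expR_ge0.
rewrite !fin_numM//; apply: integrable_fin_num => //.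
exact: integrableS (integrable_heat_moment 0 k0 ltr01).
Qed.

(** The Bessel term is bounded by a constant plus a translated integrable singularity. The heat
    factor integrates the constant and is at most 1 on the singular part. *)
Lemma integrable_bessel_heat (kap w s : R) (k : nat) : 0 < kap < 1 -> (0 < k)%N -> 0 < s ->
  leb.-integrable setT
    (EFin \o (fun l => bessel_term kap (l + w) * expR (- (s * l ^+ (2 * k))))).
Proof.
move=> k01 k0 s0; have /andP[kp k1] := k01.
have [A A0 hA] := bessel_term_le k01.
(* [N] exceeds [1 / kap], so that [1 / (2 N) <= kap / 2], as [power_singularity_le] requires. *)
pose N := (Num.bound (kap^-1)).+1.
have Npos : (0 < N)%N by [].
have hN : (2 * N)%:R^-1 <= kap / 2 :> R.
  rewrite natrM invfM mulrC ler_pM2r// invf_ple ?posrE// ltW//.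
  by rewrite (lt_le_trans (archi_boundP _)) ?invr_ge0 ?ltW// ltr_nat.
have iS := integrable_affine w ltr01 (integrable_power_singularity Npos).
have iE : leb.-integrable setT (EFin \o (fun l : R => 1 * expR (- (s * l ^+ (2 * k))))).
  by apply: (@integrable_heat_bounded R k s 1 (cst 1)) => // l; rewrite normr1.
have i1 := @integrableZl _ _ _ leb setT measurableT A _ iE.
have i2 := @integrableZl _ _ _ leb setT measurableT (A * expR 1) _ iS.
have := integrableD measurableT i1 i2.
apply: le_integrable => //.
  apply/measurable_EFinP; apply: measurable_funM; last exact: measurable_expR_power.
  apply: measurableT_comp; first exact: measurable_bessel_term.
  exact: measurable_funD.
move=> l _ /=; rewrite lee_fin !mul1r.
rewrite ger0_norm; last by apply: mulr_ge0; [exact: bessel_term_ge0|exact: expR_ge0].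
apply: le_trans (ler_norm _).
set E := expR _; have E1 : E <= 1.
  by rewrite expR_le1 oppr_le0 mulr_ge0 ?(ltW s0)// exprM exprn_ge0// sqr_ge0.
have E0 : 0 <= E by exact: expR_ge0.
set S := (_ * expR (- `|l + w|)).
have S0 : 0 <= S by rewrite mulr_ge0 ?powR_ge0 ?expR_ge0.
have hS : bessel_term kap (l + w) <= A * (1 + expR 1 * S).
  rewrite (le_trans (hA _))// ler_wpM2l// power_singularity_le ?muln_gt0//; lra.
rewrite (le_trans (ler_wpM2r E0 hS))// mulrDr mulr1 mulrDl lerD2l mulrA.
by rewrite ler_piMr// mulr_ge0// mulr_ge0// expR_ge0.
Qed.

End bessel.

(** * The spectral density: integrability against the heat factor, behaviour at 0 *)

Section spectral_density.
Context {R : realType}.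
Notation leb := (@lebesgue_measure R).
Variables (n : nat) (A w kap : 'I_n.+1 -> R).

Lemma spec_densityE (l : R) : spec_density A w kap l =
  \sum_(j < n.+1) c1 (kap j) / 2 * A j *
    (bessel_term (kap j) (l + w j) + bessel_term (kap j) (l - w j)).
Proof. by []. Qed.

Lemma spec_density_even (l : R) : spec_density A w kap (- l) = spec_density A w kap l.
Proof.
rewrite !spec_densityE; apply: eq_bigr => j _; congr (_ * _).
by rewrite -(bessel_termN _ (- l + _)) -(bessel_termN _ (- l - _)) !opprD !opprK addrC.
Qed.

Lemma c1_ge0 (x : R) : 0 <= c1 x.
Proof.
rewrite /c1 divr_ge0 ?powR_ge0// mulr_ge0 ?sqrtr_ge0//.
by apply: Rintegral_ge0 => s _; rewrite mulr_ge0 ?powR_ge0 ?expR_ge0.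
Qed.

Hypothesis A0 : forall j, 0 <= A j.
Hypothesis kap01 : forall j, 0 < kap j < 1.

Lemma spec_density_ge0 (l : R) : 0 <= spec_density A w kap l.
Proof.
rewrite spec_densityE sumr_ge0// => j _.
apply: mulr_ge0; last by apply: addr_ge0; exact: bessel_term_ge0.
by apply: mulr_ge0 => //; apply: divr_ge0 => //; exact: c1_ge0.
Qed.

Lemma measurable_spec_density : measurable_fun setT (spec_density A w kap).
Proof.
apply: measurable_sum => j; apply: measurable_funM => //; apply: measurable_funD.
  by apply: (measurableT_comp (measurable_bessel_term (kap01 j))); exact: measurable_funD.
by apply: (measurableT_comp (measurable_bessel_term (kap01 j))); exact: measurable_funB.
Qed.

Lemma integrable_spec_density_heat (s : R) (k : nat) : (0 < k)%N -> 0 < s ->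
  leb.-integrable setT
    (EFin \o (fun l => spec_density A w kap l * expR (- (s * l ^+ (2 * k))))).
Proof.
move=> k0 s0.
pose F j l := c1 (kap j) / 2 * A j *
  (bessel_term (kap j) (l + w j) * expR (- (s * l ^+ (2 * k))) +
   bessel_term (kap j) (l - w j) * expR (- (s * l ^+ (2 * k)))).
apply: (@eq_integrable _ _ _ leb setT measurableT (fun l => \sum_(j < n.+1) (F j l)%:E)%E).
  move=> l _ /=; rewrite sumEFin; congr EFin; rewrite spec_densityE mulr_suml.
  by apply: eq_bigr => j _; rewrite /F; ring.
apply: integrable_sum => // j _.
have i1 := integrable_bessel_heat (w j) (kap01 j) k0 s0.
have i2 := integrable_bessel_heat (- w j) (kap01 j) k0 s0.
exact: (integrableZl measurableT (c1 (kap j) / 2 * A j) (integrableD measurableT i1 i2)).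
Qed.

Hypothesis w0 : forall j, j != ord0 -> w j != 0.
Hypothesis Aord0 : A ord0 = 0.

(** At frequency 0 the two translates coincide by evenness, which absorbs the factor 1/2. *)
Lemma spec_density0 : spec_density A w kap 0 = Cconst A w kap.
Proof.
rewrite spec_densityE /Cconst [LHS](bigID (fun j : 'I_n.+1 => (0 < j)%N))/=.
rewrite [X in _ + X]big1 ?addr0; last first.
  move=> j; rewrite -eqn0Ngt => j0; have -> : j = ord0 by exact/val_inj/eqP.
  by rewrite Aord0 mulr0 mul0r.
apply: eq_bigr => j _; rewrite add0r sub0r bessel_termN /bessel_term.
have -> : (kap j - 1) / 2 = - ((1 - kap j) / 2) by field.
by rewrite powRN; move: (_ `^ _)^-1 => u; field.
Qed.

(** The only term whose singularity sits at 0 is that of index [ord0], and its weight is zero. The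
    others are evaluated near the nonzero points [w j] and [- w j]. *)
Lemma continuous_spec_density0 : {for 0, continuous (spec_density A w kap)}.
Proof.
rewrite /prop_for /continuous_at.
apply: cvg_big => [|j _]; first exact: add_continuous.
have [->|j0] := eqVneq j ord0.
  rewrite Aord0 mulr0 mul0r.
  under eq_fun do rewrite mul0r.
  exact: cvg_cst.
apply: cvgM; first exact: cvg_cst.
apply: cvgD.
  apply: (@continuous_comp _ _ _ (fun l => l + w j) (bessel_term (kap j))).
    by apply: cvgD; [exact: cvg_id|exact: cvg_cst].
  by apply: continuous_bessel_term => //; rewrite add0r w0.
apply: (@continuous_comp _ _ _ (fun l => l - w j) (bessel_term (kap j))).
  by apply: cvgB; [exact: cvg_id|exact: cvg_cst].
by apply: continuous_bessel_term => //; rewrite sub0r oppr_eq0 w0.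
Qed.

End spectral_density.

(** * Concentration of the dilated heat kernel at frequency 0 *)

Section heat_kernel_limit.
Context {R : realType}.
Notation leb := (@lebesgue_measure R).
Variables (k : nat) (f : R -> R).
Hypothesis k0 : (0 < k)%N.
Hypothesis f0 : forall l, 0 <= f l.
Hypothesis mf : measurable_fun setT f.
Hypothesis intf : forall s, 0 < s ->
  leb.-integrable setT (EFin \o (fun l => f l * expR (- (s * l ^+ (2 * k))))).

Let E (s l : R) := expR (- (s * l ^+ (2 * k))).

Let E_ge0 s l : 0 <= E s l. Proof. exact: expR_ge0. Qed.

Let even_pow_ge0 (l : R) : 0 <= l ^+ (2 * k).
Proof. by rewrite exprM exprn_ge0// sqr_ge0. Qed.

(* Half of the exponent pays for integrability of [f], the other half for the
   decay in [a], by [exp (- y) <= 1 / y]. *)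
Let E_tail (s a d l : R) : 0 < s -> 1 <= a -> 0 < d -> d <= `|l| ->
  E s (a * l) <= 2 / (s * d ^+ (2 * k)) / a ^+ 2 * E (s / 2) l.
Proof.
move=> s0 a1 d0 dl; have a0 : 0 < a by exact: lt_le_trans a1.
have ap1 : 1 <= a ^+ (2 * k) by rewrite exprn_ege1.
have dp0 : 0 < d ^+ (2 * k) by rewrite exprn_gt0.
have dlp : d ^+ (2 * k) <= l ^+ (2 * k).
  by rewrite -[leRHS]ger0_norm// normrX lerXn2r// ?nnegrE// ltW.
have a2 : a ^+ 2 <= a ^+ (2 * k) by rewrite ler_weXn2l// leq_pmulr.
have a20 : 0 < a ^+ 2 by rewrite exprn_gt0.
have -> : E s (a * l) = E (s / 2) (a * l) * E (s / 2) (a * l).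
  by rewrite -expRD; congr expR; field.
rewrite ler_pM//.
  set y := s / 2 * (a ^+ 2 * d ^+ (2 * k)).
  have y0 : 0 < y by rewrite mulr_gt0 ?divr_gt0// mulr_gt0.
  have -> : 2 / (s * d ^+ (2 * k)) / a ^+ 2 = y^-1.
    by rewrite /y; field; rewrite !gt_eqF.
  rewrite (@le_trans _ _ (expR (- y)))//.
    rewrite ler_expR lerN2 ler_pM2l ?divr_gt0// exprMn ler_pM// ltW//.
  rewrite expRN lef_pV2 ?posrE ?expR_gt0//.
  by rewrite (le_trans _ (expR_ge1Dx y))// lerDr.
rewrite ler_expR lerN2 ler_pM2l ?divr_gt0// exprMn.
by rewrite -[leLHS]mul1r ler_wpM2r.
Qed.

(** Undoing the dilation in the limit integral, the difference becomes [a] times the integral of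
    [G (a l) (f l - f 0)], estimated separately for [|l| < d] and [|l| >= d]. *)
Lemma heat_kernel_limit (s x : R) : 0 < s -> {for 0, continuous f} ->
  forall e, 0 < e -> exists2 M, 0 < M & forall a, M <= a ->
  `|a * \int[leb]_l (f l * (cos (a * l * x) * E s (a * l))) -
    f 0 * \int[leb]_l (cos (l * x) * E s l)| <= e.
Proof.
move=> s0 cf e e0.
pose G l := cos (l * x) * E s l.
have s20 : 0 < s / 2 by rewrite divr_gt0.
have mcos : measurable_fun setT (fun l : R => cos (l * x)).
  apply: measurableT_comp; last exact: measurable_funM.
  by apply: continuous_measurable_fun; exact: continuous_cos.
have iG : leb.-integrable setT (EFin \o G).
  by apply: (@integrable_heat_bounded R k s 1) => // l; exact: cos_max.
have iE t : 0 < t -> leb.-integrable setT (EFin \o E t).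
  move=> t0; have := @integrable_heat_bounded R k t 1 (cst 1) k0 t0.
  move=> /(_ (measurable_cst _)) h; have : leb.-integrable setT (EFin \o (fun l => 1 * E t l)).
    by apply: h => l; rewrite normr1.
  by apply: eq_integrable => // l _ /=; rewrite mul1r.
have mE t : measurable_fun setT (E t) by exact: measurable_expR_power.
pose K := \int[leb]_l E s l.
have K0 : 0 <= K by apply: Rintegral_ge0 => l _.
(* Dominates the tail: there [|f l - f 0|] is only bounded by [f l + f 0], and the factor at time
   [s / 2] left by [E_tail] makes this integrable. *)
pose H l := (f l + f 0) * E (s / 2) l.
have iH : leb.-integrable setT (EFin \o H).
  have := integrableD measurableT (intf s20)
     (@integrableZl _ _ _ leb setT measurableT (f 0) _ (iE _ s20)).
  by apply: eq_integrable => // l _ /=; rewrite -EFinM -EFinD /H mulrDl.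
pose L := \int[leb]_l H l.
have L0 : 0 <= L by apply: Rintegral_ge0 => l _; rewrite mulr_ge0// addr_ge0.
(* Makes the contribution [eta * K] of small frequencies at most [e / 2]; the [+ 1] covers
   [K = 0]. *)
pose eta := e / (2 * (K + 1)).
have eta0 : 0 < eta by rewrite divr_gt0// mulr_gt0// ltr_wpDl.
have [d d0 hd] : exists2 d : R, 0 < d & forall l, `|l| < d -> `|f l - f 0| <= eta.
  move/cvgrPdist_le : cf => /(_ _ eta0) /nbhs_ballP[d /= d0 hd].
  exists d => // l ld; rewrite distrC; apply: hd.
  by rewrite /ball/= sub0r normrN.
pose c := 2 / (s * d ^+ (2 * k)).
have c0 : 0 <= c by rewrite divr_ge0// mulr_ge0 ?ltW// exprn_gt0.
(* The 1 ensures [a >= 1] for [E_tail], and the other term makes the tail contribution [c * L / a]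
   at most [e / 2]. *)
pose M := 1 + 2 * (c * L) / e.
have M1 : 1 <= M.
  rewrite /M lerDl; apply: divr_ge0; last exact: ltW.
  by apply: mulr_ge0 => //; exact: mulr_ge0.
exists M; first exact: lt_le_trans M1.
move=> a Ma; have a1 : 1 <= a by exact: le_trans Ma.
have a0 : 0 < a by exact: lt_le_trans a1.
have iGa : leb.-integrable setT (EFin \o (fun l => G (a * l))).
  have := integrable_affine 0 a0 iG.
  by apply: eq_integrable => // l _ /=; rewrite addr0.
have iEa : leb.-integrable setT (EFin \o (fun l => E s (a * l))).
  have := integrable_affine 0 a0 (iE _ s0).
  by apply: eq_integrable => // l _ /=; rewrite addr0.
have Gle l : `|G l| <= E s l.
  by rewrite normrM [`|E _ _|]ger0_norm// ler_piMl// cos_max.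
pose D l := eta * E s (a * l) + c / a ^+ 2 * H l.
have iD : leb.-integrable setT (EFin \o D).
  have := integrableD measurableT
     (@integrableZl _ _ _ leb setT measurableT eta _ iEa)
     (@integrableZl _ _ _ leb setT measurableT (c / a ^+ 2) _ iH).
  by apply: eq_integrable.
have hD l : `|G (a * l) * (f l - f 0)| <= D l.
  rewrite normrM; have [dl|ld] := leP d `|l|.
    rewrite (@le_trans _ _ (E s (a * l) * (f l + f 0)))//.
      by rewrite ler_pM// (le_trans (ler_normB _ _))// !ger0_norm.
    rewrite (@le_trans _ _ (c / a ^+ 2 * E (s / 2) l * (f l + f 0)))//.
      by rewrite ler_wpM2r ?addr_ge0// E_tail.
    by rewrite /D /H mulrAC -mulrA lerDr mulr_ge0// ltW.
  rewrite (@le_trans _ _ (E s (a * l) * eta))//.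
    by rewrite ler_pM// hd.
  rewrite /D mulrC lerDl; apply: mulr_ge0.
    by apply: divr_ge0 => //; exact: sqr_ge0.
  by apply: mulr_ge0 => //; exact: addr_ge0.
have mGa : measurable_fun setT (fun l => G (a * l)) by case/integrableP : iGa => /measurable_EFinP.
have iGf : leb.-integrable setT (EFin \o (fun l => G (a * l) * (f l - f 0))).
  apply: (le_integrable measurableT _ _ iD).
    by apply/measurable_EFinP; apply: measurable_funM => //; exact: measurable_funB.
  by move=> l _ /=; rewrite lee_fin (le_trans (hD l))// ler_norm.
have iG0 := @integrableZl _ _ _ leb setT measurableT (f 0) _ iGa.
have -> : \int[leb]_l (f l * (cos (a * l * x) * E s (a * l))) =
    \int[leb]_l (G (a * l) * (f l - f 0)) + f 0 * \int[leb]_l G (a * l).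
  rewrite -RintegralZl// -RintegralD//.
  by apply: eq_Rintegral => l _; rewrite /G; ring.
have -> : \int[leb]_l (cos (l * x) * E s l) = a * \int[leb]_l G (a * l).
  rewrite -/(G _) (@Rintegral_affine R a 0 G a0 iG); congr (_ * _).
  by apply: eq_Rintegral => l _; rewrite addr0.
have -> (u v : R) : a * (u + f 0 * v) - f 0 * (a * v) = a * u by ring.
rewrite normrM gtr0_norm//.
have hI : `|\int[leb]_l (G (a * l) * (f l - f 0))| <= \int[leb]_l D l.
  rewrite (le_trans (le_normr_Rintegral measurableT iGf))//.
  apply: le_Rintegral => //.
  apply: (le_integrable measurableT _ _ iD).
    apply/measurable_EFinP; apply: measurableT_comp => //.
    by case/integrableP : iGf => /measurable_EFinP.
  by move=> l _ /=; rewrite lee_fin normr_id (le_trans (hD l))// ler_norm.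
rewrite (le_trans (ler_wpM2l (ltW a0) hI))//.
have -> : \int[leb]_l D l = eta * (K / a) + c / a ^+ 2 * L.
  rewrite /D RintegralD//; last 2 first.
  - exact: (@integrableZl _ _ _ leb setT measurableT eta _ iEa).
  - exact: (@integrableZl _ _ _ leb setT measurableT (c / a ^+ 2) _ iH).
  rewrite !RintegralZl//; congr (_ * _ + _).
  rewrite /K (@Rintegral_affine R a 0 (E s) a0 (iE _ s0)) mulrC mulrA mulVf ?gt_eqF// mul1r.
  by apply: eq_Rintegral => l _; rewrite addr0.
have -> : a * (eta * (K / a) + c / a ^+ 2 * L) = eta * K + c * L / a.
  by field; rewrite gt_eqF.
have h1 : eta * K <= e / 2.
  rewrite /eta mulrAC ler_pdivrMr ?mulr_gt0 ?ltr_wpDl//.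
  have -> : e / 2 * (2 * (K + 1)) = e * (K + 1) by field.
  by rewrite ler_pM2l// lerDl.
have h2 : c * L / a <= e / 2.
  rewrite ler_pdivrMr// (@le_trans _ _ (e / 2 * M))//; last by rewrite ler_pM2l ?divr_gt0.
  have -> : e / 2 * M = e / 2 + c * L by rewrite /M; field; rewrite gt_eqF.
  by rewrite lerDr divr_ge0 ?ltW.
by rewrite [leRHS](splitr e) lerD.
Qed.

End heat_kernel_limit.

(** * The algebra of real trigonometric polynomials *)

Section trigonometric_polynomials.
Context {R : realType} {N : nat}.

(** The phase [b] lets one generator produce sines, cosines and constants. Each generator depends on
    [v] through a single linear form, the only quantity whose law is given. *)
Inductive trigpoly : ('rV[R]_N -> R) -> Prop :=
| trigpoly_cos (a : R) (L : 'I_N -> R) (b : R) :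
    trigpoly (fun v => a * cos (\sum_i L i * v 0 i + b))
| trigpolyD (g h : 'rV[R]_N -> R) :
    trigpoly g -> trigpoly h -> trigpoly (fun v => g v + h v).

Lemma eq_trigpoly (g h : 'rV[R]_N -> R) : (forall v, g v = h v) -> trigpoly g -> trigpoly h.
Proof. by move=> gh; have -> : h = g by apply/funext => v; rewrite gh. Qed.

Lemma trigpoly_cst (c : R) : trigpoly (fun=> c).
Proof.
apply: eq_trigpoly (trigpoly_cos c (fun=> 0) 0) => v.
by rewrite big1 ?addr0 ?cos0 ?mulr1// => i _; rewrite mul0r.
Qed.

(** The product-to-sum formula for cosines; phases and linear forms are added and subtracted. *)
Lemma trigpoly_cosM (a : R) (L : 'I_N -> R) (b : R) (h : 'rV[R]_N -> R) : trigpoly h ->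
  trigpoly (fun v => a * cos (\sum_i L i * v 0 i + b) * h v).
Proof.
elim=> [a' L' b'|g1 g2 _ IH1 _ IH2]; last first.
  by apply: eq_trigpoly (trigpolyD IH1 IH2) => v; rewrite mulrDr.
apply: eq_trigpoly (trigpolyD
  (trigpoly_cos (a * a' / 2) (fun i => L i + L' i) (b + b'))
  (trigpoly_cos (a * a' / 2) (fun i => L i - L' i) (b - b'))) => v /=.
have -> : \sum_i (L i + L' i) * v 0 i + (b + b') =
    (\sum_i L i * v 0 i + b) + (\sum_i L' i * v 0 i + b').
  by under eq_bigr do rewrite mulrDl; rewrite big_split/= addrACA.
have -> : \sum_i (L i - L' i) * v 0 i + (b - b') =
    (\sum_i L i * v 0 i + b) - (\sum_i L' i * v 0 i + b').
  by under eq_bigr do rewrite mulrBl; rewrite sumrB; ring.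
by rewrite cosD cosB; field.
Qed.

Lemma trigpolyM (g h : 'rV[R]_N -> R) : trigpoly g -> trigpoly h ->
  trigpoly (fun v => g v * h v).
Proof.
move=> tg th; elim: tg => [a L b|g1 g2 _ IH1 _ IH2]; first exact: trigpoly_cosM.
by apply: eq_trigpoly (trigpolyD IH1 IH2) => v; rewrite mulrDl.
Qed.

Lemma trigpoly_sum (J : Type) (r : seq J) (g : J -> 'rV[R]_N -> R) :
  (forall j, trigpoly (g j)) -> trigpoly (fun v => \sum_(j <- r) g j v).
Proof.
move=> tg; elim: r => [|j r IH].
  by apply: eq_trigpoly (trigpoly_cst 0) => v; rewrite big_nil.
by apply: eq_trigpoly (trigpolyD (tg j) IH) => v; rewrite big_cons.
Qed.

Lemma trigpoly_prod (J : Type) (r : seq J) (g : J -> 'rV[R]_N -> R) :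
  (forall j, trigpoly (g j)) -> trigpoly (fun v => \prod_(j <- r) g j v).
Proof.
move=> tg; elim: r => [|j r IH].
  by apply: eq_trigpoly (trigpoly_cst 1) => v; rewrite big_nil.
by apply: eq_trigpoly (trigpolyM (tg j) IH) => v; rewrite big_cons.
Qed.

Lemma trigpoly_sin (h : R) (i : 'I_N) : trigpoly (fun v => sin (h * v 0 i)).
Proof.
apply: eq_trigpoly (trigpoly_cos 1 (fun j => if j == i then h else 0) (- (pi / 2))) => v.
rewrite (bigD1 i)//= eqxx big1 ?addr0 ?mul1r ?cosBpihalf// => j /negPf ->.
by rewrite mul0r.
Qed.

End trigonometric_polynomials.

(* A multivariate Bernstein operator: [y] in the cube [-1, 1]^N is the mean of
   independent signs, and [n] signs are drawn per coordinate. *)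
Section sign_averages.
Context {R : realType} {N n : nat}.
Hypothesis n0 : (0 < n)%N.
Notation cell := ('I_N * 'I_n)%type.
Notation omega := {ffun cell -> bool}.

Definition sgb (b : bool) : R := if b then 1 else -1.
Definition sign_weight (y : 'I_N -> R) (w : omega) : R :=
  \prod_(c : cell) ((1 + sgb (w c) * y c.1) / 2).
Definition sign_avg (w : omega) (i : 'I_N) : R := n%:R^-1 * \sum_(j < n) sgb (w (i, j)).

Variable y : 'I_N -> R.
Hypothesis y1 : forall i, `|y i| <= 1.

Lemma sign_weight_ge0 w : 0 <= sign_weight y w.
Proof.
apply: prodr_ge0 => c _; rewrite divr_ge0//.
have := y1 c.1; rewrite ler_norml => /andP[h1 h2].
by rewrite /sgb; case: (w c); lra.
Qed.

(** Independence of the signs: the mean of a product over cells is the product of the means, by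
    distributivity of products over sums. *)
Lemma sum_sign_weight_prod (F : cell -> bool -> R) :
  \sum_(w : omega) sign_weight y w * \prod_c F c (w c) =
  \prod_(c : cell) ((1 + y c.1) / 2 * F c true + (1 - y c.1) / 2 * F c false).
Proof.
transitivity (\prod_(c : cell) \sum_(b : bool) (1 + sgb b * y c.1) / 2 * F c b).
  rewrite (bigA_distr_bigA (fun c b => (1 + sgb b * y c.1) / 2 * F c b)).
  by apply: eq_bigr => w _; rewrite -big_split.
by apply: eq_bigr => c _; rewrite big_bool /sgb mul1r mulN1r.
Qed.

Lemma sum_sign_weight : \sum_(w : omega) sign_weight y w = 1.
Proof.
transitivity (\sum_(w : omega) sign_weight y w * \prod_(c : cell) (fun _ _ => 1) c (w c)).
  by apply: eq_bigr => w _; rewrite big1 ?mulr1.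
by rewrite (sum_sign_weight_prod (fun _ _ => 1)) big1// => c _; field.
Qed.

Lemma sign_weight_cov (c c' : cell) : c != c' ->
  \sum_(w : omega) sign_weight y w * ((sgb (w c) - y c.1) * (sgb (w c') - y c'.1)) = 0.
Proof.
move=> cc'.
(* A product of one factor per cell, equal to the centered signs at [c] and [c'] and to 1 elsewhere;
   the factor at [c] has mean 0. *)
pose F (d : cell) (b : bool) := (if d == c then sgb b - y c.1 else 1) *
  (if d == c' then sgb b - y c'.1 else 1).
transitivity (\sum_(w : omega) sign_weight y w * \prod_d F d (w d)).
  apply: eq_bigr => w _; congr (_ * _); rewrite big_split/=.
  by rewrite -!big_mkcond/= !big_pred1_eq.
rewrite sum_sign_weight_prod (bigD1 c)//= /F eqxx (negPf cc') /sgb.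
by rewrite (_ : _ / 2 * _ + _ = 0) ?mul0r//; field.
Qed.

(** Off-diagonal covariances vanish, and each of the [n] diagonal terms is at most 4 because
    [|sgb b - y i| <= 2]. *)
Lemma sign_avg_var (i : 'I_N) :
  \sum_(w : omega) sign_weight y w * (sign_avg w i - y i) ^+ 2 <= 4 / n%:R.
Proof.
have nR : 0 < n%:R :> R by rewrite ltr0n.
pose d (w : omega) j := sgb (w (i, j)) - y i.
have dE w : sign_avg w i - y i = n%:R^-1 * \sum_(j < n) d w j.
  rewrite /sign_avg /d sumrB mulrBr; congr (_ - _).
  by rewrite sumr_const card_ord -[y i *+ n]mulr_natl mulrA mulVf ?mul1r// gt_eqF.
have -> : \sum_(w : omega) sign_weight y w * (sign_avg w i - y i) ^+ 2 =
   n%:R^-1 ^+ 2 * \sum_(j < n) \sum_(j' < n) \sum_(w : omega)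
      sign_weight y w * (d w j * d w j').
  transitivity (\sum_(w : omega) n%:R^-1 ^+ 2 * \sum_(j < n) \sum_(j' < n)
      sign_weight y w * (d w j * d w j')).
    apply: eq_bigr => w _; rewrite dE exprMn mulrCA; congr (_ * _).
    rewrite expr2 mulr_suml mulr_sumr; apply: eq_bigr => j _.
    by rewrite mulr_sumr mulr_sumr.
  rewrite -mulr_sumr exchange_big/=; congr (_ * _).
  by apply: eq_bigr => j _; rewrite exchange_big.
have diag j : \sum_(j' < n) \sum_(w : omega) sign_weight y w * (d w j * d w j') <= 4.
  rewrite (bigD1 j)//= [X in _ + X]big1 ?addr0; last first.
    move=> j' jj'; apply: sign_weight_cov; apply: contra jj' => /eqP[->] //.
  apply: (@le_trans _ _ (\sum_(w : omega) sign_weight y w * 4)); last first.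
    by rewrite -mulr_suml sum_sign_weight mul1r.
  apply: ler_sum => w _; rewrite ler_wpM2l ?sign_weight_ge0//.
  have := y1 i; rewrite ler_norml => /andP[h1 h2].
  by rewrite /d /sgb; case: (w _); nra.
apply: (@le_trans _ _ (n%:R^-1 ^+ 2 * \sum_(j < n) 4)).
  by rewrite ler_wpM2l ?exprn_ge0 ?invr_ge0// ler_sum.
rewrite sumr_const card_ord -[4 *+ n]mulr_natl.
have -> : n%:R^-1 ^+ 2 * (n%:R * 4) = 4 / n%:R :> R by field; rewrite gt_eqF.
by [].
Qed.

End sign_averages.

(** * Approximating bounded continuous functions on boxes *)

Section trigonometric_approximation.
Context {R : realType} {N : nat}.
Variables (phi : 'rV[R]_N -> R) (B : R).
Hypothesis cphi : continuous phi.
Hypothesis phiB : forall v, `|phi v| <= B.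

(** Only [u] is confined to the box. The sample points compared with it later may lie outside. *)
Lemma box_unif_continuous (K e : R) : 0 < e -> exists2 d : R, 0 < d &
  forall u v : 'rV[R]_N, (forall i, `|u 0 i| <= K) -> (forall i, `|u 0 i - v 0 i| < d) ->
  `|phi u - phi v| <= e.
Proof.
move=> e0.
have cK : compact [set v : 'rV[R]_N | forall i, `[- K, K]%classic (v ord0 i)].
  by apply: (@rV_compact _ _ (fun=> `[- K, K]%classic)) => i; exact: segment_compact.
move/compact_near_coveringP : cK.
pose P (d : R) (u : 'rV[R]_N) := forall v : 'rV[R]_N,
  (forall i, `|u 0 i - v 0 i| < d) -> `|phi u - phi v| <= e.
move=> /(_ R (0 : R)^'+ P _) H.
have /H : forall x : 'rV[R]_N, [set v : 'rV[R]_N | forall i, `[- K, K]%classic (v ord0 i)] x ->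
    \forall x' \near x & d \near (0 : R)^'+, P d x'.
  move=> x _; have e20 : 0 < e / 2 by rewrite divr_gt0.
  have /cvgrPdist_le /(_ _ e20) /nbhs_ballP[r /= r0 hr] := @cphi x.
  have r20 : 0 < r / 2 by rewrite divr_gt0.
  (* Half of the radius pays for the distance from [x] to [u], the other half for that from [u] to
     [v]. *)
  exists (ball x (r / 2), [set d | 0 < d < r / 2]) => /=.
    split; first exact: nbhsx_ballx.
    near=> d; apply/andP; split; near: d; first exact: nbhs_right_gt.
    exact: nbhs_right_lt.
  move=> [u d] [/= [_ xu] /andP[d0 dr]] v uv.
  have h1 : `|phi x - phi u| <= e / 2.
    apply: hr; split => // i j; apply: le_ball (xu i j).
    by rewrite ler_pdivrMr// ler_peMr ?ler1n// ltW.
  have h2 : `|phi x - phi v| <= e / 2.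
    apply: hr; split => // i j; rewrite (splitr r); apply: (ball_triangle (xu i j)).
    by rewrite (ord1 i) /ball/=; exact: lt_trans (uv j) dr.
  rewrite (splitr e) (_ : phi u - phi v = (phi x - phi v) - (phi x - phi u)); last by ring.
  by rewrite (le_trans (ler_normB _ _))// lerD.
move=> Hn; have [d [Pd d0]] : exists d : R,
   (forall u : 'rV[R]_N, (forall i, `[- K, K]%classic (u ord0 i)) -> forall v : 'rV[R]_N,
      (forall i, `|u 0 i - v 0 i| < d) -> `|phi u - phi v| <= e) /\ 0 < d.
  near ((0 : R)^'+) => d; exists d; split.
    by near: d.
  by near: d; exact: nbhs_right_gt.
exists d => // u v uK uv; apply: Pd => // i /=.
by rewrite in_itv/= -ler_norml.
Unshelve. all: by end_near. Qed.

(** The derivative of [sin] at 0 is 1. A single [h] serves all [|x| <= K], since only [h * x] has to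
    be small. *)
Lemma sin_slope (K d : R) : 0 < K -> 0 < d ->
  exists2 h : R, 0 < h & forall x, `|x| <= K -> `|sin (h * x) / h - x| < d.
Proof.
move=> K0 d0; have dK0 : 0 < d / (2 * K) by rewrite divr_gt0// mulr_gt0.
have Hd : (t^-1 *: (sin (t *: (1 : R) + 0) - sin 0)) @[t --> (0 : R)^'] --> (1 : R).
  rewrite -[X in _ --> X](_ : 'D_1 (@sin R) 0 = 1); last by rewrite derive_val cos0.
  exact: (@derivable_sin R 0).
move/cvgrPdist_le : Hd => /(_ _ dK0) /nbhs_ballP[r /= r0 hr].
exists (r / (2 * K)); first by rewrite divr_gt0// mulr_gt0.
move=> x xK; set h := r / (2 * K).
have h0 : 0 < h by rewrite divr_gt0// mulr_gt0.
have [->|x0] := eqVneq x 0; first by rewrite mulr0 sin0 mul0r subr0 normr0.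
have hx0 : h * x != 0 by rewrite mulf_neq0// gt_eqF.
have : `|1 - (h * x)^-1 *: (sin ((h * x) *: (1 : R) + 0) - sin 0)| <= d / (2 * K).
  apply: hr => //; rewrite /ball/= sub0r normrN normrM gtr0_norm//.
  rewrite (@le_lt_trans _ _ (h * K))//; first by rewrite ler_pM2l.
  have -> : h * K = r / 2 by rewrite /h; field; rewrite gt_eqF.
  by rewrite ltr_pdivrMr// ltr_pMr// ltr1n.
rewrite sin0 subr0 addr0 /GRing.scale/= mulr1 => hh.
have -> : sin (h * x) / h - x = - x * (1 - (h * x)^-1 * sin (h * x)).
  by field; rewrite x0 gt_eqF.
rewrite normrM normrN (le_lt_trans (ler_pM _ _ xK hh))//.
have -> : K * (d / (2 * K)) = d / 2 by field; rewrite gt_eqF.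
by rewrite ltr_pdivrMr// ltr_pMr// ltr1n.
Qed.

(** [Q v] averages [phi] over the points [sign_avg w / h], with signs of mean [sin (h v_i)]. This
    mean lies in [[-1, 1]] for every [v], so the weights stay nonnegative on the whole space. *)
Lemma trigpoly_approx (K e : R) : 0 < K -> 0 < e ->
  exists2 Q : 'rV[R]_N -> R, trigpoly Q & (forall v, `|Q v| <= B) /\
    (forall v : 'rV[R]_N, (forall i, `|v 0 i| <= K) -> `|phi v - Q v| <= e).
Proof.
move=> K0 e0; have e30 : 0 < e / 3 by rewrite divr_gt0.
have B0 : 0 <= B by exact: le_trans (phiB 0).
(* The box is enlarged by 1 because uniform continuity is applied at [u], which is within [d <= 1]
   of [v]. *)
have [d' d'0 hd'] := box_unif_continuous (K + 1) e30.
pose d := Num.min d' 1.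
have d0 : 0 < d by rewrite lt_min d'0 ltr01.
have d1 : d <= 1 by rewrite ge_min lexx orbT.
have dd' : d <= d' by rewrite ge_min lexx.
have [h h0 hh] := sin_slope K0 d0.
(* Large enough that the Chebyshev remainder, with variance at most [4 / n] in each of the [N]
   coordinates, is at most [e / 3]. *)
pose n := (Num.bound ((e / 3)^-1 * (2 * B * (N%:R * 4) / (h * d) ^+ 2))).+1.
have n0 : (0 < n)%N by [].
have hd0 : 0 < (h * d) ^+ 2 by rewrite exprn_gt0// mulr_gt0.
have c0 : 0 <= 2 * B / (h * d) ^+ 2.
  by apply: divr_ge0; [exact: mulr_ge0|exact: ltW].
have hn : 2 * B * (N%:R * (4 / n%:R)) / (h * d) ^+ 2 <= e / 3.
  have nR : 0 < n%:R :> R by [].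
  have -> : 2 * B * (N%:R * (4 / n%:R)) / (h * d) ^+ 2 =
     2 * B * (N%:R * 4) / (h * d) ^+ 2 / n%:R.
    by field; rewrite pnatr_eq0/= !gt_eqF.
  rewrite ler_pdivrMr// -ler_pdivrMl//.
  rewrite ltW// (lt_le_trans (archi_boundP _)) ?ler_nat//.
  apply: mulr_ge0; first by rewrite invr_ge0 ltW.
  by apply: divr_ge0; [rewrite !mulr_ge0|exact: ltW].
pose y (v : 'rV[R]_N) i := sin (h * v 0 i).
have y1 v i : `|y v i| <= 1 by exact: sin_max.
pose pt (w : {ffun 'I_N * 'I_n -> bool}) : 'rV[R]_N := \row_i (sign_avg w i / h).
pose Q v := \sum_(w : {ffun 'I_N * 'I_n -> bool}) sign_weight (y v) w * phi (pt w).
exists Q.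
  rewrite /Q; apply: trigpoly_sum => w; apply: trigpolyM; last exact: trigpoly_cst.
  rewrite /sign_weight; apply: trigpoly_prod => c.
  apply: trigpolyM; last exact: trigpoly_cst.
  apply: trigpolyD; first exact: trigpoly_cst.
  by apply: trigpolyM; [exact: trigpoly_cst|exact: trigpoly_sin].
split=> v.
  rewrite (le_trans (ler_norm_sum _ _ _))//.
  rewrite -[leRHS]mul1r -(sum_sign_weight (n := n) (y v)) mulr_suml.
  apply: ler_sum => w _; rewrite normrM ger0_norm ?sign_weight_ge0//.
  by rewrite ler_wpM2l// sign_weight_ge0.
move=> vK; pose u : 'rV[R]_N := \row_i (y v i / h).
have uv i : `|v 0 i - u 0 i| < d by rewrite mxE distrC hh.
have hu : `|phi v - phi u| <= e / 3.
  apply: hd'; first by move=> i; rewrite (le_trans (vK i))// lerDl.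
  by move=> i; rewrite (lt_le_trans (uv i)).
have uK i : `|u 0 i| <= K + 1.
  have -> : u 0 i = v 0 i - (v 0 i - u 0 i) by ring.
  by rewrite (le_trans (ler_normB _ _))// lerD// (le_trans (ltW (uv i))).
have hQ : `|phi u - Q v| <= e / 3 + e / 3.
  have -> : phi u - Q v = \sum_(w : {ffun 'I_N * 'I_n -> bool})
      sign_weight (y v) w * (phi u - phi (pt w)).
    under eq_bigr do rewrite mulrBr.
    by rewrite sumrB -mulr_suml sum_sign_weight mul1r.
  rewrite (le_trans (ler_norm_sum _ _ _))//.
  (* If the sample point is within [d] of [u], uniform continuity gives [e / 3]. Otherwise some
     [sign_avg w i] misses [y v i] by at least [h * d], so the quadratic term exceeds the trivial
     bound [2 * B]. *)
  apply: (@le_trans _ _ (\sum_(w : {ffun 'I_N * 'I_n -> bool}) sign_weight (y v) w *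
     (e / 3 + 2 * B / (h * d) ^+ 2 * \sum_i (sign_avg w i - y v i) ^+ 2))).
    apply: ler_sum => w _; rewrite normrM ger0_norm ?sign_weight_ge0//.
    rewrite ler_wpM2l ?sign_weight_ge0//.
    have S0 : 0 <= 2 * B / (h * d) ^+ 2 * \sum_i (sign_avg w i - y v i) ^+ 2.
      by apply: mulr_ge0 => //; apply: sumr_ge0 => i _; exact: sqr_ge0.
    case: (pselect (forall i, `|u 0 i - pt w 0 i| < d)) => [up|/existsNP[i /negP]].
      rewrite (le_trans (hd' _ _ uK _)) ?lerDl// => i.
      exact: lt_le_trans (up i) _.
    rewrite -leNgt !mxE -mulrBl normrM normfV (gtr0_norm h0) ler_pdivlMr// => hi.
    rewrite (@le_trans _ _ (2 * B))//.
      by rewrite (le_trans (ler_normB _ _))// mulr_natl mulr2n lerD.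
    rewrite ler_wpDl ?(ltW e30)// mulrAC ler_pdivlMr// ler_wpM2l ?mulr_ge0//.
    rewrite (bigD1 i)//= (@le_trans _ _ ((sign_avg w i - y v i) ^+ 2))//.
      have dh0 : 0 <= d * h by apply: mulr_ge0; exact: ltW.
      by rewrite -[leRHS]real_normK ?num_real// distrC [h * d]mulrC lerXn2r ?nnegrE.
    by rewrite lerDl; apply: sumr_ge0 => j _; exact: sqr_ge0.
  under eq_bigr do rewrite mulrDr.
  rewrite big_split/= -mulr_suml sum_sign_weight mul1r lerD2l.
  apply: le_trans hn.
  have -> : \sum_(w : {ffun 'I_N * 'I_n -> bool}) sign_weight (y v) w *
     (2 * B / (h * d) ^+ 2 * \sum_i (sign_avg w i - y v i) ^+ 2) =
     2 * B / (h * d) ^+ 2 * \sum_i \sum_(w : {ffun 'I_N * 'I_n -> bool})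
       sign_weight (y v) w * (sign_avg w i - y v i) ^+ 2.
    under eq_bigr do rewrite mulrCA mulr_sumr.
    by rewrite -mulr_sumr exchange_big.
  rewrite [leRHS]mulrAC ler_wpM2l//.
  apply: (@le_trans _ _ (\sum_(i < N) (4 / n%:R))).
    by apply: ler_sum => i _; exact: sign_avg_var.
  by rewrite sumr_const card_ord -[_ *+ N]mulr_natl.
have -> : phi v - Q v = (phi v - phi u) + (phi u - Q v) by ring.
rewrite (le_trans (ler_normD _ _))// (le_trans (lerD hu hQ))//; lra.
Qed.

End trigonometric_approximation.

(** * Integrals against the normal law *)

Section normal_expectation.
Context {R : realType}.
Notation leb := (@lebesgue_measure R).

(** The Radon-Nikodym derivative of the law agrees almost everywhere with [normal_pdf]. Boundedness
    supplies the integrability asked for by the change of measure. *)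
Lemma integral_normal_bounded (s C : R) (g : R -> R) :
  measurable_fun setT g -> (forall x, `|g x| <= C) ->
  (\int[normal_prob 0 s]_x (g x)%:E = \int[leb]_x (g x * normal_pdf 0 s x)%:E)%E.
Proof.
move=> mg gC.
have dom := @normal_prob_dominates R 0 s.
have mpdf := @measurable_normal_pdf R 0 s.
have ig : (normal_prob 0 s).-integrable setT (EFin \o g).
  apply: (@le_integrable _ _ _ _ setT measurableT _ (cst C%:E)).
  - exact/measurable_EFinP.
  - by move=> x _ /=; rewrite lee_fin (le_trans (gC x))// ler_norm.
  - exact: finite_measure_integrable_cst.
rewrite -(Radon_Nikodym_change_of_variables dom)//.
under [RHS]eq_integral do rewrite EFinM.
apply: ae_eq_integral => //.
- apply: emeasurable_funM; first exact/measurable_EFinP.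
  by apply: (measurable_int leb); exact: Radon_Nikodym_integrable.
- by apply: emeasurable_funM; exact/measurable_EFinP.
- apply: ae_eqe_mul2l => /=.
  rewrite Radon_NikodymE//=.
  case: cid => /= h [h1 h2 h3].
  apply: integral_ae_eq => //=.
  + exact/measurable_EFinP.
  + by move=> E _ mE; rewrite -h3.
Qed.

Lemma min_nat_cvg (x : R) : 0 <= x -> (Num.min x n%:R)%:E @[n --> \oo] --> x%:E.
Proof.
move=> x0; apply: cvg_near_cst; exists (Num.bound x) => // n /= bn.
by rewrite min_l// ltW// (lt_le_trans (archi_boundP x0))// ler_nat.
Qed.

(** Truncation at level [n] and monotone convergence on both sides. *)
Lemma ge0_integral_normal (s : R) (g : R -> R) :
  measurable_fun setT g -> (forall x, 0 <= g x) ->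
  (\int[normal_prob 0 s]_x (g x)%:E = \int[leb]_x (g x * normal_pdf 0 s x)%:E)%E.
Proof.
move=> mg g0.
pose t n x : R := Num.min (g x) n%:R.
have t0 n x : 0 <= t n x by rewrite le_min g0/=.
have mt n : measurable_fun setT (t n) by exact: measurable_minr.
have tn n x : `|t n x| <= n%:R by rewrite ger0_norm// ge_min lexx orbT.
have ndt x m n : (m <= n)%N -> t m x <= t n x.
  by move=> mn; rewrite le_min !ge_min lexx/= ler_nat mn orbT.
have c1 : (\int[normal_prob 0 s]_x (t n x)%:E)%E @[n --> \oo] -->
    (\int[normal_prob 0 s]_x (g x)%:E)%E.
  rewrite [X in _ --> X](_ : _ =
     (\int[normal_prob 0 s]_x limn (fun n => (t n x)%:E))%E); last first.
    by apply: eq_integral => x _; apply/esym/cvg_lim => //; exact: min_nat_cvg.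
  apply: cvg_monotone_convergence => //.
  - by move=> n; apply/measurable_EFinP; exact: mt.
  - by move=> n x _; rewrite lee_fin.
  - by move=> x _ m n mn; rewrite lee_fin ndt.
have c2 : (\int[leb]_x (t n x * normal_pdf 0 s x)%:E)%E @[n --> \oo] -->
    (\int[leb]_x (g x * normal_pdf 0 s x)%:E)%E.
  rewrite [X in _ --> X](_ : _ =
     (\int[leb]_x limn (fun n => (t n x * normal_pdf 0 s x)%:E))%E); last first.
    apply: eq_integral => x _; apply/esym/cvg_lim => //.
    under eq_fun do rewrite EFinM.
    rewrite EFinM; apply: cvgeZr => //; exact: min_nat_cvg.
  apply: cvg_monotone_convergence => //.
  - move=> n; apply/measurable_EFinP; apply: measurable_funM; first exact: mt.
    exact: measurable_normal_pdf.
  - by move=> n x _; rewrite lee_fin mulr_ge0// normal_pdf_ge0.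
  - by move=> x _ m n mn; rewrite lee_fin ler_wpM2r ?normal_pdf_ge0// ndt.
move: c1; under eq_fun do rewrite (@integral_normal_bounded s _ _ (mt _) (tn _)).
by move=> c1; exact: (cvg_unique _ c1 c2).
Qed.

Lemma normal_pdf_gauss (s u : R) : 0 < s ->
  s * Num.sqrt 2 * normal_pdf 0 s (s * Num.sqrt 2 * u) = gauss_fun u / Num.sqrt pi.
Proof.
move=> s0; rewrite /normal_pdf (gt_eqF s0) /normal_peak /normal_fun /gauss_fun.
have s2 : 0 < Num.sqrt 2 :> R by rewrite sqrtr_gt0.
have sp : 0 < Num.sqrt pi :> R by rewrite sqrtr_gt0 pi_gt0.
have -> : Num.sqrt (s ^+ 2 * pi *+ 2) = s * Num.sqrt pi * Num.sqrt 2.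
  have -> : s ^+ 2 * pi *+ 2 = (s * Num.sqrt pi * Num.sqrt 2) ^+ 2.
    by rewrite !exprMn !sqr_sqrtr ?pi_ge0// mulr_natr.
  by rewrite sqrtr_sqr gtr0_norm// !mulr_gt0.
have -> : - (s * Num.sqrt 2 * u - 0) ^+ 2 / (s ^+ 2 *+ 2) = - u ^+ 2.
  rewrite subr0 !exprMn sqr_sqrtr// -[s ^+ 2 *+ 2]mulr_natr; field; exact: lt0r_neq0.
by field; rewrite !gt_eqF.
Qed.

(** Here the standard deviation occurs only in the argument of [g], against a fixed weight; in this
    form the formula extends to zero variance. *)
Lemma ge0_integral_normal_gauss (s : R) (g : R -> R) : 0 < s ->
  measurable_fun setT g -> (forall x, 0 <= g x) ->
  (\int[normal_prob 0 s]_x (g x)%:E =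
   \int[leb]_u (g (s * Num.sqrt 2 * u) * (gauss_fun u / Num.sqrt pi))%:E)%E.
Proof.
move=> s0 mg g0; rewrite ge0_integral_normal//.
have a0 : 0 < s * Num.sqrt 2 by rewrite mulr_gt0// sqrtr_gt0.
have mgp : measurable_fun setT (fun x => g x * normal_pdf 0 s x).
  by apply: measurable_funM => //; exact: measurable_normal_pdf.
rewrite (@ge0_integral_affine R _ 0 _ a0); last 2 first.
- exact/measurable_EFinP.
- by move=> x; rewrite lee_fin mulr_ge0// normal_pdf_ge0.
rewrite -ge0_integralZl//=; last 3 first.
- apply/measurable_EFinP.
  exact: (measurableT_comp mgp (measurable_affine _ _)).
- by move=> x _; rewrite lee_fin mulr_ge0// normal_pdf_ge0.
- exact: ltW.
apply: eq_integral => u _; rewrite -EFinM addr0 -(normal_pdf_gauss u s0); congr EFin; ring.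
Qed.

End normal_expectation.

(** * Expectations of functions of one centered Gaussian variable *)

Section centered_gaussian_moments.
Context {R : realType} {d : measure_display} {T : measurableType d}.
Variable P : probability T R.
Notation leb := (@lebesgue_measure R).

Lemma bounded_integrable (g : T -> R) (C : R) : measurable_fun setT g ->
  (forall x, `|g x| <= C) -> P.-integrable setT (EFin \o g).
Proof.
move=> mg gC; apply: (@le_integrable _ _ _ _ setT measurableT _ (cst C%:E)).
- exact/measurable_EFinP.
- by move=> x _ /=; rewrite lee_fin (le_trans (gC x))// ler_norm.
- exact: finite_measure_integrable_cst.
Qed.

Lemma expectation_bounded (g : T -> R) (C : R) : measurable_fun setT g ->
  (forall x, `|g x| <= C) -> ('E_P[g] = (\int[P]_x g x)%:E)%E.
Proof.
move=> mg gC; rewrite unlock /Rintegral fineK//.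
by apply: integrable_fin_num => //; exact: bounded_integrable gC.
Qed.

Lemma measurable_preimage (X : T -> R) (B : set R) : measurable_fun setT X ->
  measurable B -> measurable (X @^-1` B).
Proof. by move=> mX mB; rewrite -[X in measurable X]setTI; exact: mX. Qed.

Lemma ae0_law (X : T -> R) (B : set R) : measurable_fun setT X ->
  P (X @^-1` [set 0]) = 1%E -> measurable B ->
  P (X @^-1` B) = ((0 \in B)%:R)%:E.
Proof.
move=> mX X0 mB; have mX0 : measurable (X @^-1` [set 0]) by exact: measurable_preimage.
have mXB : measurable (X @^-1` B) by exact: measurable_preimage.
have [|B0] := boolP (0 \in B); first rewrite inE => B0.
  apply/eqP; rewrite eq_le probability_le1//= -X0.
  by rewrite le_measure ?inE// => x /= ->.
apply/eqP; rewrite eq_le measure_ge0 andbT.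
rewrite (@le_trans _ _ (P (~` (X @^-1` [set 0]))))//.
  rewrite le_measure ?inE//; first exact: measurableC.
  by move=> x /= Bx X0'; move: B0; rewrite notin_setE; apply; rewrite -X0'.
by rewrite probability_setC// X0 subee.
Qed.

Lemma centered_gaussian_law (X Y : T -> R) (v : R) (B : set R) :
  centered_gaussian P X v -> centered_gaussian P Y v -> measurable B ->
  P (X @^-1` B) = P (Y @^-1` B).
Proof.
move=> [mX hX] [mY hY] mB; move: hX hY; case: ifPn => v0 hX hY.
  by rewrite (ae0_law mX hX mB) (ae0_law mY hY mB).
by rewrite hX// hY.
Qed.

Lemma centered_gaussian_Rintegral (X Y : T -> R) (v : R) (g : R -> R) :
  centered_gaussian P X v -> centered_gaussian P Y v -> measurable_fun setT g ->
  P.-integrable setT (EFin \o (g \o X)) -> P.-integrable setT (EFin \o (g \o Y)) ->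
  \int[P]_x g (X x) = \int[P]_x g (Y x).
Proof.
move=> gX gY mg iX iY; have [mX _] := gX; have [mY _] := gY.
rewrite /Rintegral; congr fine.
have mgE : measurable_fun setT (EFin \o g) by exact/measurable_EFinP.
rewrite -[LHS](@integral_pushforward _ _ _ _ _ _ mX P setT (EFin \o g))//.
rewrite -[RHS](@integral_pushforward _ _ _ _ _ _ mY P setT (EFin \o g))//.
by apply: eq_measure_integral => B mB _; exact: centered_gaussian_law gX gY mB.
Qed.

(** When [v = 0], [X] vanishes almost surely and both sides equal [g 0], the weight having total
    mass 1. *)
Lemma ge0_integral_centered_gaussian (X : T -> R) (v : R) (g : R -> R) : 0 <= v ->
  centered_gaussian P X v -> measurable_fun setT g -> (forall x, 0 <= g x) ->
  (\int[P]_x (g (X x))%:E =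
   \int[leb]_u (g (Num.sqrt v * Num.sqrt 2 * u) * (gauss_fun u / Num.sqrt pi))%:E)%E.
Proof.
move=> v0 gX mg g0; have [mX hX] := gX.
have spi : 0 < Num.sqrt pi :> R by rewrite sqrtr_gt0 pi_gt0.
have mgE : measurable_fun setT (EFin \o g) by exact/measurable_EFinP.
move: hX; case: ifPn => [/eqP vE hX|vE hX].
  rewrite vE sqrtr0; transitivity (g 0)%:E.
    transitivity (\int[P]_x (cst (g 0)%:E x))%E; last first.
      by rewrite integral_cst//= probability_setT mule1.
    apply: ae_eq_integral => //.
      by apply/measurable_EFinP; exact: measurableT_comp.
    exists (~` (X @^-1` [set 0])); split.
    - by apply: measurableC; exact: measurable_preimage.
    - transitivity (1 - P (X @^-1` [set 0%R]))%E; last by rewrite hX subee.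
      by apply: probability_setC; exact: measurable_preimage.
    - by move=> x /=; apply: contra_not => ->.
  under eq_integral do rewrite !mul0r.
  under eq_integral do rewrite mulrCA mulrC EFinM.
  rewrite ge0_integralZl//=; last 3 first.
  - by apply/measurable_EFinP; exact: measurable_gauss_fun.
  - by move=> u _; rewrite lee_fin gauss_fun_ge0.
  - by rewrite lee_fin mulr_ge0// invr_ge0 ltW.
  by rewrite integralT_gauss -EFinM -mulrA mulVf ?mulr1// gt_eqF.
have vgt : 0 < v by rewrite lt_neqAle eq_sym vE.
rewrite -ge0_integral_normal_gauss ?sqrtr_gt0//.
transitivity (\int[pushforward P (X : T -> measurableTypeR R)]_x (g x)%:E)%E.
  by rewrite ge0_integral_pushforward// => x; rewrite lee_fin.
by apply: eq_measure_integral => B mB _; exact: hX.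
Qed.

(** Proved as an extended-real identity so that square integrability can be read off from it. *)
Lemma centered_gaussian_sqr (X : T -> R) (v : R) : 0 <= v -> centered_gaussian P X v ->
  (\int[P]_x (X x ^+ 2)%:E = v%:E)%E.
Proof.
move=> v0 gX.
have spi : 0 < Num.sqrt pi :> R by rewrite sqrtr_gt0 pi_gt0.
rewrite (@ge0_integral_centered_gaussian X v (fun x => x ^+ 2))//; last first.
  by move=> x; exact: sqr_ge0.
transitivity (\int[leb]_u ((2 * v / Num.sqrt pi)%:E * (u ^+ 2 * gauss_fun u)%:E))%E.
  apply: eq_integral => u _; rewrite -EFinM !exprMn !sqr_sqrtr//; congr EFin.
  by field; rewrite gt_eqF.
have im := @integrable_heat_moment R 1 2 1 isT ltr01.
have E1 : (\int[leb]_u (u ^+ 2 * gauss_fun u)%:E = (Num.sqrt pi / 2)%:E)%E.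
  transitivity (\int[leb]_u (u ^+ 2 * expR (- (1 * u ^+ (2 * 1))))%:E)%E.
    by apply: eq_integral => u _; rewrite mul1r muln1.
  rewrite -[LHS]fineK; last exact: integrable_fin_num im.
  congr EFin; have := @gauss_moment R 1; rewrite /Rintegral muln1 => ->.
  by rewrite !factS fact0 expr1; field.
rewrite ge0_integralZl//=.
- by rewrite E1 -EFinM; congr EFin; field; rewrite gt_eqF.
- apply/measurable_EFinP; apply: measurable_funM => //; exact: measurable_gauss_fun.
- by move=> u _; rewrite lee_fin mulr_ge0 ?sqr_ge0 ?gauss_fun_ge0.
- by rewrite lee_fin; apply: divr_ge0; [exact: mulr_ge0|exact: ltW].
Qed.

Lemma centered_gaussian_integrable_sqr (X : T -> R) (v : R) : 0 <= v ->
  centered_gaussian P X v -> P.-integrable setT (EFin \o (fun x => X x ^+ 2)).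
Proof.
move=> v0 gX; have [mX _] := gX; apply/integrableP; split.
  by apply/measurable_EFinP; exact: measurable_funX.
under eq_integral do rewrite /= ger0_norm ?sqr_ge0//.
by rewrite (centered_gaussian_sqr v0 gX) ltry.
Qed.

Lemma centered_gaussian_Rintegral_sqr (X : T -> R) (v : R) : 0 <= v ->
  centered_gaussian P X v -> \int[P]_x (X x ^+ 2) = v.
Proof. by move=> v0 gX; rewrite /Rintegral (centered_gaussian_sqr v0 gX). Qed.

(** The expectation of [cos (a Z + b)] for a standard normal [Z], written as [sqrt 2 * u] under the
    weight [gauss_fun u / sqrt pi]. What matters is its continuity in [a], including at 0. *)
Definition gauss_cos (b a : R) : R :=
  \int[leb]_u (cos (a * Num.sqrt 2 * u + b) * (gauss_fun u / Num.sqrt pi)).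

Lemma integrable_gauss_cos (b a : R) :
  leb.-integrable setT (EFin \o (fun u => cos (a * Num.sqrt 2 * u + b) * (gauss_fun u / Num.sqrt pi))).
Proof.
have := @integrableZl _ _ _ leb setT measurableT (Num.sqrt pi)^-1 _ (@integrableT_gauss R).
apply: le_integrable => //.
  apply/measurable_EFinP; apply: measurable_funM.
    apply: measurableT_comp; last exact: measurable_affine.
    by apply: continuous_measurable_fun; exact: continuous_cos.
  by apply: measurable_funM => //; exact: measurable_gauss_fun.
move=> u _; rewrite /= lee_fin normrM mulrC [_^-1 * _]mulrC.
by rewrite ler_piMr// cos_max.
Qed.

Lemma gaussian_cos (X : T -> R) (v b : R) : 0 <= v -> centered_gaussian P X v ->
  \int[P]_x cos (X x + b) = gauss_cos b (Num.sqrt v).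
Proof.
move=> v0 gX; have [mX _] := gX.
have spi : 0 < Num.sqrt pi :> R by rewrite sqrtr_gt0 pi_gt0.
have mc : measurable_fun setT (fun x : R => cos (x + b)).
  apply: measurableT_comp; last exact: measurable_funD.
  by apply: continuous_measurable_fun; exact: continuous_cos.
(* Adding 1 makes the cosine nonnegative, so the formula for nonnegative functions applies; the 1 is
   subtracted again at the end. *)
have := @ge0_integral_centered_gaussian X v (fun x => 1 + cos (x + b)) v0 gX.
move=> /(_ (measurable_funD (measurable_cst _) mc)) /(_ _)/wrap[].
  by move=> x; rewrite -lerBlDl sub0r cos_geN1.
move=> /(congr1 fine); rewrite -!/(Rintegral _ _ _) => H.
have iX : P.-integrable setT (EFin \o (fun x => cos (X x + b))).
  apply: (@bounded_integrable _ 1); first exact: measurableT_comp mc mX.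
  by move=> x; exact: cos_max.
have i1 : P.-integrable setT (EFin \o (fun=> 1 : R)).
  by apply: (@bounded_integrable _ 1) => // x; rewrite normr1.
have L : \int[P]_x (1 + cos (X x + b)) = 1 + \int[P]_x cos (X x + b).
  by rewrite RintegralD// Rintegral_cst//= probability_setT mulr1.
have ig : leb.-integrable setT (EFin \o (fun u : R => gauss_fun u / Num.sqrt pi)).
  have := @integrableZl _ _ _ leb setT measurableT (Num.sqrt pi)^-1 _ (@integrableT_gauss R).
  by apply: eq_integrable => // u _ /=; rewrite -EFinM mulrC.
have Rr : \int[leb]_u ((1 + cos (Num.sqrt v * Num.sqrt 2 * u + b)) * (gauss_fun u / Num.sqrt pi)) =
   1 + gauss_cos b (Num.sqrt v).
  under eq_Rintegral do rewrite mulrDl mul1r.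
  rewrite RintegralD//; last exact: integrable_gauss_cos.
  congr (_ + _).
  rewrite RintegralZr//; last exact: integrableT_gauss.
  by rewrite /Rintegral integralT_gauss/= divff// gt_eqF.
by apply: (@addrI _ 1); rewrite -L -Rr.
Qed.

Lemma continuous_gauss_cos (b : R) : continuous (gauss_cos b).
Proof.
move=> a.
have := @continuity_under_integral R _ _ leb
  (fun a u => cos (a * Num.sqrt 2 * u + b) * (gauss_fun u / Num.sqrt pi)) setT measurableT
  (a - 1) (a + 1) _ _ (fun u => gauss_fun u / Num.sqrt pi).
apply => //.
- by move=> x _; exact: integrable_gauss_cos.
- apply: aeW => u _ x _; apply: cvgM; last exact: cvg_cst.
  apply: continuous_comp; last exact: continuous_cos.
  apply: cvgD; last exact: cvg_cst.
  apply: cvgM; last exact: cvg_cst.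
  by apply: cvgM; [exact: cvg_id|exact: cvg_cst].
- have := @integrableZl _ _ _ leb setT measurableT (Num.sqrt pi)^-1 _ (@integrableT_gauss R).
  by apply: eq_integrable => // u _ /=; rewrite -EFinM mulrC.
- move=> x _; apply: aeW => u _.
  rewrite normrM [X in _ * X]ger0_norm; last by rewrite divr_ge0 ?gauss_fun_ge0 ?sqrtr_ge0.
  by rewrite ler_piMl ?cos_max// divr_ge0 ?gauss_fun_ge0 ?sqrtr_ge0.
- by rewrite inE/= in_itv/=; apply/andP; split; lra.
Qed.

End centered_gaussian_moments.

(** * Weak convergence of Gaussian vectors from convergence of covariances *)

Section gaussian_weak_convergence.
Context {R : realType} {d : measure_display} {T : measurableType d}.
Variables (P : probability T R) (N : nat).

Lemma Rintegral_sum d' (T' : measurableType d') (mu : {measure set T' -> \bar R})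
    (J : Type) (r : seq J) (g : J -> T' -> R) :
  (forall j, mu.-integrable setT (EFin \o g j)) ->
  mu.-integrable setT (EFin \o (fun x => \sum_(j <- r) g j x)) /\
  \int[mu]_x (\sum_(j <- r) g j x) = \sum_(j <- r) \int[mu]_x g j x.
Proof.
move=> ig; elim: r => [|j r [IH1 IH2]].
  split.
    by apply: eq_integrable (integrable0 _ _) => // x _ /=; rewrite big_nil.
  by under eq_Rintegral do rewrite big_nil; rewrite Rintegral_cst// mul0r big_nil.
have E : (fun x => \sum_(i <- j :: r) g i x) = (fun x => g j x + \sum_(i <- r) g i x).
  by apply/funext => x; rewrite big_cons.
split; first by rewrite E; exact: (integrableD measurableT (ig j) IH1).
by rewrite E RintegralD// IH2 big_cons.
Qed.

Definition quad_form (S : 'I_N -> 'I_N -> R) (c : 'I_N -> R) : R :=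
  \sum_(i < N) \sum_(j < N) c i * c j * S i j.

(** Joint Gaussianity through all linear combinations. Nonnegativity of the variance is recorded
    because [Num.sqrt] sends negative numbers to 0. *)
Definition gaussian_family (V : 'I_N -> T -> R) (S : 'I_N -> 'I_N -> R) : Prop :=
  forall c : 'I_N -> R, 0 <= quad_form S c /\
    centered_gaussian P (fun om => \sum_(i < N) c i * V i om) (quad_form S c).

Lemma gaussian_family_coord V S (i : 'I_N) : gaussian_family V S ->
  0 <= S i i /\ centered_gaussian P (V i) (S i i).
Proof.
move=> /(_ (fun j => (j == i)%:R)) [].
have -> : quad_form S (fun j => (j == i)%:R) = S i i.
  rewrite /quad_form (bigD1 i)//= [X in _ + X]big1 ?addr0; last first.
    by move=> j /negPf ->; rewrite big1// => l _; rewrite !mul0r.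
  rewrite (bigD1 i)//= eqxx [X in _ + X]big1 ?addr0 ?mul1r//.
  by move=> j /negPf ->; rewrite mulr0 mul0r.
have -> : (fun om => \sum_(j < N) (j == i)%:R * V j om) = V i.
  apply/funext => om; rewrite (bigD1 i)//= eqxx mul1r [X in _ + X]big1 ?addr0//.
  by move=> j /negPf ->; rewrite mul0r.
by [].
Qed.

Lemma gaussian_family_measurable V S i : gaussian_family V S -> measurable_fun setT (V i).
Proof. by move=> /(gaussian_family_coord i)[_ []]. Qed.

Lemma measurable_trigpoly (V : 'I_N -> T -> R) (Q : 'rV[R]_N -> R) :
  (forall i, measurable_fun setT (V i)) -> trigpoly Q ->
  measurable_fun setT (fun om => Q (\row_i V i om)).
Proof.
move=> mV; elim=> [a L b|g h _ IHg _ IHh]; last exact: measurable_funD.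
rewrite (_ : (fun om => _) = (fun om => a * cos (\sum_i L i * V i om + b))); last first.
  by apply/funext => om; under eq_bigr do rewrite mxE.
apply: measurable_funM => //; apply: measurableT_comp.
  by apply: continuous_measurable_fun; exact: continuous_cos.
apply: measurable_funD => //; apply: measurable_sum => i.
exact: measurable_funM.
Qed.

Lemma trigpoly_bounded (Q : 'rV[R]_N -> R) : trigpoly Q -> exists C, forall v, `|Q v| <= C.
Proof.
elim=> [a L b|g h _ [C hC] _ [D hD]].
  by exists `|a| => v; rewrite normrM ler_piMr// cos_max.
by exists (C + D) => v; rewrite (le_trans (ler_normD _ _))// lerD.
Qed.

(** A pointwise limit of trigonometric polynomials in the coordinates, close to [phi] within
    [1/(n+1)] on the box of size [n+1]. *)
Lemma measurable_continuous_row (V : 'I_N -> T -> R) (phi : 'rV[R]_N -> R) (B : R) :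
  continuous phi -> (forall v, `|phi v| <= B) -> (forall i, measurable_fun setT (V i)) ->
  measurable_fun setT (fun om => phi (\row_i V i om)).
Proof.
move=> cphi phiB mV.
have /choice[q hq] : forall n : nat, exists Q : 'rV[R]_N -> R, trigpoly Q /\
    forall v : 'rV[R]_N, (forall i, `|v 0 i| <= n.+1%:R) -> `|phi v - Q v| <= n.+1%:R^-1.
  move=> n; have [||Q tQ [_ hQ]] := @trigpoly_approx R N phi B cphi phiB n.+1%:R n.+1%:R^-1 => //.
  by exists Q.
apply: (@measurable_fun_cvg _ _ _ _ (fun n om => q n (\row_i V i om))).
  by move=> n; apply: measurable_trigpoly => //; exact: (hq n).1.
move=> om _; set v := \row_i V i om.
apply/cvgrPdist_le => e e0.
exists (Num.bound (\sum_i `|v 0 i| + e^-1)) => // n /= bn.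
have s0 : 0 <= \sum_i `|v 0 i| by apply: sumr_ge0.
have ei0 : 0 < e^-1 by rewrite invr_gt0.
have hb : \sum_i `|v 0 i| + e^-1 <= n.+1%:R.
  rewrite ltW// (lt_le_trans (archi_boundP _)) ?addr_ge0 ?(ltW ei0)//.
  by rewrite ler_nat (leq_trans bn).
rewrite (le_trans ((hq n).2 v _))//.
  move=> i; apply: le_trans hb; rewrite (bigD1 i)//= -addrA lerDl addr_ge0 ?(ltW ei0)//.
  by apply: sumr_ge0.
rewrite invf_ple ?posrE//; apply: le_trans hb; by rewrite lerDr.
Qed.

(** The expectation of a generator is [gauss_cos] at the square root of the variance of its linear
    form, a continuous function of the covariance matrix. *)
Lemma gaussian_family_trigpoly (X : R -> 'I_N -> T -> R) (Y : 'I_N -> T -> R)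
    (S : R -> 'I_N -> 'I_N -> R) (S0 : 'I_N -> 'I_N -> R) (Q : 'rV[R]_N -> R) :
  (\forall e \near 0^'+, gaussian_family (X e) (S e)) -> gaussian_family Y S0 ->
  (forall i j, S e i j @[e --> 0^'+] --> S0 i j) -> trigpoly Q ->
  (\int[P]_om Q (\row_i X e i om)) @[e --> 0^'+] --> \int[P]_om Q (\row_i Y i om).
Proof.
move=> gX gY SS0.
have iQ V S' (Q' : 'rV[R]_N -> R) : gaussian_family V S' -> trigpoly Q' ->
    P.-integrable setT (EFin \o (fun om => Q' (\row_i V i om))).
  move=> gV tQ; have [C hC] := trigpoly_bounded tQ.
  apply: (@bounded_integrable _ _ _ _ _ C) => //; apply: measurable_trigpoly => // i.
  exact: gaussian_family_measurable gV.
elim=> [a L b|g h tg IHg th IHh].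
  have E V S' : gaussian_family V S' ->
      \int[P]_om (a * cos (\sum_i L i * (\row_i V i om) 0 i + b)) =
      a * gauss_cos b (Num.sqrt (quad_form S' L)).
    move=> gV; have [q0 cg] := gV L.
    rewrite -(gaussian_cos b q0 cg) -RintegralZl//.
      by apply: eq_Rintegral => om _; under eq_bigr do rewrite mxE.
    apply: (@bounded_integrable _ _ _ _ _ 1); last by move=> om; exact: cos_max.
    have [mV _] := cg; apply: measurableT_comp; last exact: measurable_funD.
    by apply: continuous_measurable_fun; exact: continuous_cos.
  rewrite (E _ _ gY).
  apply: (@cvg_trans _ ((a * gauss_cos b (Num.sqrt (quad_form (S e) L))) @[e --> 0^'+])).
    apply: near_eq_cvg; near=> e.
    have gXe : gaussian_family (X e) (S e) by near: e.
    by rewrite (E _ _ gXe).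
  apply: cvgM; first exact: cvg_cst.
  apply: continuous_cvg; first exact: continuous_gauss_cos.
  apply: continuous_cvg; first exact: sqrt_continuous.
  rewrite /quad_form; apply: cvg_big => [|i _]; first exact: add_continuous.
  apply: cvg_big => [|j _]; first exact: add_continuous.
  by apply: cvgM; [exact: cvg_cst|exact: SS0].
rewrite RintegralD//; [|exact: iQ gY _|exact: iQ gY _].
apply: (@cvg_trans _ ((\int[P]_om g (\row_i X e i om) +
    \int[P]_om h (\row_i X e i om)) @[e --> 0^'+])).
  apply: near_eq_cvg; near=> e.
  have gXe : gaussian_family (X e) (S e) by near: e.
  by rewrite RintegralD//; [exact: iQ gXe _|exact: iQ gXe _].
by apply: cvgD.
Unshelve. all: by end_near. Qed.

(** Chebyshev: outside the box the difference is at most [2 * B], hence at most [2 * B / K ^ 2]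
    times the squared norm, whose mean is the trace of [S]. *)
Lemma gaussian_family_dist V S (phi Q : 'rV[R]_N -> R) (B K e : R) :
  gaussian_family V S -> continuous phi -> trigpoly Q ->
  (forall v, `|phi v| <= B) -> (forall v, `|Q v| <= B) -> 0 < K -> 0 <= e ->
  (forall v : 'rV[R]_N, (forall i, `|v 0 i| <= K) -> `|phi v - Q v| <= e) ->
  `|\int[P]_om phi (\row_i V i om) - \int[P]_om Q (\row_i V i om)| <=
    e + 2 * B / K ^+ 2 * \sum_i S i i.
Proof.
move=> gV cphi tQ phiB QB K0 e0 hK.
have mV i : measurable_fun setT (V i) by exact: gaussian_family_measurable gV.
have mphi := measurable_continuous_row cphi phiB mV.
have mQ := measurable_trigpoly mV tQ.
have ip : P.-integrable setT (EFin \o (fun om => phi (\row_i V i om))).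
  exact: (@bounded_integrable _ _ _ _ _ B).
have iQ : P.-integrable setT (EFin \o (fun om => Q (\row_i V i om))).
  exact: (@bounded_integrable _ _ _ _ _ B).
have B0 : 0 <= B by exact: le_trans (phiB 0).
have K20 : 0 < K ^+ 2 by rewrite exprn_gt0.
have c0 : 0 <= 2 * B / K ^+ 2 by apply: divr_ge0; [exact: mulr_ge0|exact: ltW].
have pw v : `|phi v - Q v| <= e + 2 * B / K ^+ 2 * \sum_i v 0 i ^+ 2.
  have S0 : 0 <= \sum_i v 0 i ^+ 2 by apply: sumr_ge0 => i _; exact: sqr_ge0.
  case: (pselect (forall i, `|v 0 i| <= K)) => [/hK h|/existsNP[i /negP]].
    by rewrite (le_trans h)// lerDl mulr_ge0.
  rewrite -ltNge => Ki; rewrite (@le_trans _ _ (2 * B))//.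
    by rewrite (le_trans (ler_normB _ _))// mulr_natl mulr2n lerD.
  rewrite ler_wpDl// mulrAC ler_pdivlMr// ler_wpM2l ?mulr_ge0//.
  rewrite (bigD1 i)//= (@le_trans _ _ (v 0 i ^+ 2))//.
    rewrite -[leRHS]real_normK ?num_real// lerXn2r ?nnegrE//; exact: ltW.
  by rewrite lerDl; apply: sumr_ge0 => j _; exact: sqr_ge0.
have iV i : P.-integrable setT (EFin \o (fun om => V i om ^+ 2)).
  by have [s0 cg] := gaussian_family_coord i gV; exact: centered_gaussian_integrable_sqr cg.
have [iS ES] := Rintegral_sum (index_enum 'I_N) iV.
have icS := @integrableZl _ _ _ P setT measurableT (2 * B / K ^+ 2) _ iS.
have ie : P.-integrable setT (EFin \o (fun=> e)).
  by apply: (@bounded_integrable _ _ _ _ _ `|e|).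
rewrite -RintegralB// (le_trans (le_normr_Rintegral _ _))//.
  exact: (integrableB measurableT ip iQ).
apply: (@le_trans _ _ (\int[P]_om (e + 2 * B / K ^+ 2 * \sum_i V i om ^+ 2))).
  apply: le_Rintegral => //.
  - apply: (@bounded_integrable _ _ _ _ _ (B + B)).
      by apply: measurableT_comp => //; exact: measurable_funB.
    by move=> om; rewrite normr_id (le_trans (ler_normB _ _))// lerD.
  - exact: (integrableD measurableT ie icS).
  - move=> om _; rewrite (le_trans (pw _))//.
    by under eq_bigr do rewrite mxE.
rewrite RintegralD// RintegralZl// ES Rintegral_cst//= probability_setT mulr1 lerD2l.
rewrite ler_wpM2l//; apply: ler_sum => i _.
by have [s0 cg] := gaussian_family_coord i gV; rewrite (centered_gaussian_Rintegral_sqr s0 cg).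
Qed.

Lemma gaussian_family_cvg (X : R -> 'I_N -> T -> R) (Y : 'I_N -> T -> R)
    (S : R -> 'I_N -> 'I_N -> R) (S0 : 'I_N -> 'I_N -> R) (phi : 'rV[R]_N -> R) (B : R) :
  (\forall e \near 0^'+, gaussian_family (X e) (S e)) -> gaussian_family Y S0 ->
  (forall i j, S e i j @[e --> 0^'+] --> S0 i j) ->
  continuous phi -> (forall v, `|phi v| <= B) ->
  ('E_P[fun om => phi (\row_i X e i om)])%E @[e --> 0^'+] -->
  ('E_P[fun om => phi (\row_i Y i om)])%E.
Proof.
move=> gX gY SS0 cphi phiB.
have EE V S' : gaussian_family V S' -> ('E_P[fun om => phi (\row_i V i om)] =
    (\int[P]_om phi (\row_i V i om))%:E)%E.
  move=> gV; apply: (@expectation_bounded _ _ _ _ _ B) => //.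
  apply: measurable_continuous_row cphi phiB _ => i.
  exact: gaussian_family_measurable gV.
rewrite (EE _ _ gY).
apply: (@cvg_trans _ ((\int[P]_om phi (\row_i X e i om))%:E @[e --> 0^'+])).
  apply: near_eq_cvg; near=> e.
  have gXe : gaussian_family (X e) (S e) by near: e.
  by rewrite (EE _ _ gXe).
apply: cvg_EFin; first exact: nearW.
apply/cvgrPdist_le => eta eta0.
have B0 : 0 <= B by exact: le_trans (phiB 0).
(* Bounds the trace of [S0] and, for small [e], that of [S e], so one box and one [Q] serve them
   all. *)
pose M := \sum_i S0 i i + 1.
have M0 : 0 <= M.
  by rewrite addr_ge0//; apply: sumr_ge0 => i _; exact: (gaussian_family_coord i gY).1.
(* Chosen so that [K <= K ^ 2] and [2 * B * M / K <= eta / 6]. *)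
pose K := 1 + 12 * B * M / eta.
have K1 : 1 <= K.
  by rewrite /K lerDl; apply: divr_ge0; [rewrite !mulr_ge0|exact: ltW].
have K0 : 0 < K by exact: lt_le_trans K1.
have e60 : 0 < eta / 6 by rewrite divr_gt0.
have hM : 2 * B / K ^+ 2 * M <= eta / 6.
  rewrite mulrAC ler_pdivrMr ?exprn_gt0//.
  have KK : K <= K ^+ 2 by rewrite expr2 ler_peMr// ltW.
  rewrite (@le_trans _ _ (eta / 6 * K))//; last by rewrite ler_pM2l.
  have -> : eta / 6 * K = eta / 6 + 2 * B * M by rewrite /K; field; rewrite gt_eqF.
  by rewrite lerDr ltW.
have [Q tQ [QB hQ]] := @trigpoly_approx R N phi B cphi phiB K (eta / 6) K0 e60.
have c0 : 0 <= 2 * B / K ^+ 2.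
  by apply: divr_ge0; [exact: mulr_ge0|exact/ltW/exprn_gt0].
have dist V S' : gaussian_family V S' -> \sum_i S' i i <= M ->
    `|\int[P]_om phi (\row_i V i om) - \int[P]_om Q (\row_i V i om)| <= eta / 3.
  move=> gV hS; have := gaussian_family_dist gV cphi tQ phiB QB K0 (ltW e60) hQ.
  move=> /le_trans; apply.
  have := ler_wpM2l c0 hS; lra.
have cQ := gaussian_family_trigpoly gX gY SS0 tQ.
have cS : (\sum_i S e i i) @[e --> 0^'+] --> \sum_i S0 i i.
  by apply: cvg_big => [|i _]; [exact: add_continuous|exact: SS0].
have e30 : 0 < eta / 3 by rewrite divr_gt0.
near=> e.
have gXe : gaussian_family (X e) (S e) by near: e.
have hSe : \sum_i S e i i <= M.
  have : `|\sum_i S0 i i - \sum_i S e i i| <= 1.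
    by near: e; move/cvgrPdist_le : cS; apply.
  by rewrite ler_norml /M; lra.
have hQe : `|\int[P]_om Q (\row_i Y i om) - \int[P]_om Q (\row_i X e i om)| <= eta / 3.
  by near: e; move/cvgrPdist_le : cQ; apply.
have h1 := dist _ _ gXe hSe.
have h2 : `|\int[P]_om phi (\row_i Y i om) - \int[P]_om Q (\row_i Y i om)| <= eta / 3.
  by apply: (dist _ _ gY); rewrite /M lerDl.
move: h1 h2 hQe => /=; rewrite !ler_norml; lra.
Unshelve. all: by end_near. Qed.

End gaussian_weak_convergence.

(** * Mean and covariance of white-noise integrals *)

Section white_noise.
Context {R : realType} {d : measure_display} {T : measurableType d}.
Variables (P : probability T R) (I : (R -> R) * (R -> R) -> T -> R).
Notation leb := (@lebesgue_measure R).
Hypothesis WN : white_noise_integral P I.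

Lemma inner2C (h g : (R -> R) * (R -> R)) : inner2 h g = inner2 g h.
Proof. by apply: eq_Rintegral => l _; rewrite mulrC [h.2 l * _]mulrC. Qed.

Lemma inner2_ge0 (h : (R -> R) * (R -> R)) : 0 <= inner2 h h.
Proof. by apply: Rintegral_ge0 => l _; rewrite -!expr2 addr_ge0 ?sqr_ge0. Qed.

Lemma integrable_prod_L2 (u v : R -> R) : measurable_fun setT u -> measurable_fun setT v ->
  leb.-integrable setT (fun l => (u l ^+ 2)%:E) ->
  leb.-integrable setT (fun l => (v l ^+ 2)%:E) ->
  leb.-integrable setT (EFin \o (fun l => u l * v l)).
Proof.
move=> mu mv iu iv; have := integrableD measurableT iu iv; apply: le_integrable => //.
  by apply/measurable_EFinP; exact: measurable_funM.
move=> l _ /=; rewrite lee_fin [leRHS]ger0_norm ?addr_ge0 ?sqr_ge0//.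
rewrite ler_norml; have := sqr_ge0 (u l - v l); have := sqr_ge0 (u l + v l).
have := sqr_ge0 (u l); have := sqr_ge0 (v l); nra.
Qed.

Lemma integrable_inner2 (h g : (R -> R) * (R -> R)) : hermitian_L2 h -> hermitian_L2 g ->
  leb.-integrable setT (EFin \o (fun l => h.1 l * g.1 l + h.2 l * g.2 l)).
Proof.
move=> [mh1 mh2 _ ih1 ih2] [mg1 mg2 _ ig1 ig2].
exact: (integrableD measurableT (integrable_prod_L2 mh1 mg1 ih1 ig1)
  (integrable_prod_L2 mh2 mg2 ih2 ig2)).
Qed.

(** The form is the integral of the squared modulus of the combination of the [h i] with
    coefficients [c i]. *)
Lemma inner2_quad_ge0 (N : nat) (h : 'I_N -> (R -> R) * (R -> R)) (c : 'I_N -> R) :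
  (forall i, hermitian_L2 (h i)) -> 0 <= quad_form (fun i j => inner2 (h i) (h j)) c.
Proof.
move=> hh.
pose w i j l := c i * c j * ((h i).1 l * (h j).1 l + (h i).2 l * (h j).2 l).
have iw i j : leb.-integrable setT (EFin \o w i j).
  exact: (integrableZl measurableT (c i * c j) (integrable_inner2 (hh i) (hh j))).
have E1 i := Rintegral_sum (index_enum 'I_N) (iw i).
have [_ E2] := Rintegral_sum (index_enum 'I_N) (fun i => (E1 i).1).
have -> : quad_form (fun i j => inner2 (h i) (h j)) c =
    \int[leb]_l (\sum_(i < N) \sum_(j < N) w i j l).
  rewrite E2; apply: eq_bigr => i _; rewrite (E1 i).2; apply: eq_bigr => j _.
  by rewrite RintegralZl//; exact: integrable_inner2.
apply: Rintegral_ge0 => l _.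
have -> : \sum_(i < N) \sum_(j < N) w i j l =
    (\sum_(i < N) c i * (h i).1 l) ^+ 2 + (\sum_(i < N) c i * (h i).2 l) ^+ 2.
  rewrite !expr2 !big_distrlr -big_split/=; apply: eq_bigr => i _.
  by rewrite -big_split/=; apply: eq_bigr => j _; rewrite /w; ring.
by rewrite addr_ge0 ?sqr_ge0.
Qed.

Lemma white_noise_family (N : nat) (h : 'I_N -> (R -> R) * (R -> R)) (b : R) :
  (forall i, hermitian_L2 (h i)) ->
  gaussian_family P (fun i om => b * I (h i) om) (fun i j => b ^+ 2 * inner2 (h i) (h j)).
Proof.
move=> hh c.
have qE : quad_form (fun i j => b ^+ 2 * inner2 (h i) (h j)) c =
    quad_form (fun i j => inner2 (h i) (h j)) (fun i => c i * b).
  by apply: eq_bigr => i _; apply: eq_bigr => j _; ring.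
split; first by rewrite qE; exact: inner2_quad_ge0.
rewrite qE (_ : (fun om => _) = (fun om => \sum_(i < N) c i * b * I (h i) om)).
  exact: WN.
by apply/funext => om; apply: eq_bigr => i _; rewrite mulrA.
Qed.

Lemma white_noise_scale (a : R) h : hermitian_L2 h ->
  centered_gaussian P (fun om => a * I h om) (a ^+ 2 * inner2 h h).
Proof.
move=> hh; have := WN (fun=> a : R) (fun _ : 'I_1 => hh).
under eq_fun do rewrite big_ord_recl big_ord0 addr0.
by rewrite !big_ord_recl !big_ord0 !addr0 -expr2.
Qed.

Lemma white_noise_gaussian h : hermitian_L2 h -> centered_gaussian P (I h) (inner2 h h).
Proof.
move=> hh; have := white_noise_scale 1 hh; rewrite expr1n mul1r.
by under eq_fun do rewrite mul1r.
Qed.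

(** Prepares the polarization in [white_noise_cov]. *)
Lemma white_noise_add h g : hermitian_L2 h -> hermitian_L2 g ->
  let v := inner2 h h + inner2 h g + (inner2 h g + inner2 g g) in
  0 <= v /\ centered_gaussian P (fun om => I h om + I g om) v.
Proof.
move=> hh hg v.
have H (i : 'I_2) : hermitian_L2 (if i == ord0 then h else g) by case: ifP.
have [q0] := white_noise_family 1 H (fun=> 1).
have vE : quad_form (fun i j : 'I_2 => 1 ^+ 2 * inner2 (if i == ord0 then h else g)
    (if j == ord0 then h else g)) (fun=> 1) = v.
  rewrite /quad_form !big_ord_recl !big_ord0/= !addr0 expr1n !mul1r.
  by rewrite [inner2 g h]inner2C.
rewrite vE in q0 *; under eq_fun do rewrite !big_ord_recl big_ord0 addr0/= !mul1r.
by [].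
Qed.

Lemma white_noise_integrable_sqr h : hermitian_L2 h ->
  P.-integrable setT (EFin \o (fun om => I h om ^+ 2)).
Proof.
move=> hh; exact: centered_gaussian_integrable_sqr (inner2_ge0 h) (white_noise_gaussian hh).
Qed.

Lemma white_noise_measurable h : hermitian_L2 h -> measurable_fun setT (I h).
Proof. by move=> /white_noise_gaussian[]. Qed.

Lemma integrable_cst1 : P.-integrable setT (EFin \o (fun=> 1 : R)).
Proof. by apply: (@bounded_integrable _ _ _ _ _ 1) => // x; rewrite normr1. Qed.

Lemma white_noise_integrable h : hermitian_L2 h -> P.-integrable setT (EFin \o I h).
Proof.
move=> hh; have := integrableD measurableT integrable_cst1 (white_noise_integrable_sqr hh).
apply: le_integrable => //; first exact/measurable_EFinP/white_noise_measurable.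
move=> om _ /=; rewrite lee_fin [leRHS]ger0_norm ?addr_ge0 ?sqr_ge0//.
rewrite ler_norml; have := sqr_ge0 (I h om - 1); have := sqr_ge0 (I h om + 1); nra.
Qed.

(* By symmetry: [I h] and [- I h] have the same law. *)
Lemma white_noise_mean h : hermitian_L2 h -> \int[P]_om I h om = 0.
Proof.
move=> hh; have i1 := white_noise_integrable hh.
have g2 := white_noise_scale (-1) hh; rewrite sqrrN expr1n mul1r in g2.
have i2 : P.-integrable setT (EFin \o (fun om => -1 * I h om)).
  exact: (integrableZl measurableT (-1) i1).
have := @centered_gaussian_Rintegral R d T P _ _ _ (@id R) (white_noise_gaussian hh) g2.
move=> /(_ (@measurable_id _ _ _) i1 i2); rewrite RintegralZl//.
set J := Rintegral _ _ _ => h0; lra.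
Qed.

(** Polarization: the second moments of [I h], [I g] and their sum are known, and expanding the
    square isolates the cross term. *)
Lemma white_noise_cov h g : hermitian_L2 h -> hermitian_L2 g ->
  P.-integrable setT (EFin \o (fun om => I h om * I g om)) /\
  \int[P]_om (I h om * I g om) = inner2 h g.
Proof.
move=> hh hg.
have ih := white_noise_integrable_sqr hh; have ig := white_noise_integrable_sqr hg.
have ihg : P.-integrable setT (EFin \o (fun om => I h om * I g om)).
  have := integrableD measurableT ih ig; apply: le_integrable => //.
    by apply/measurable_EFinP; apply: measurable_funM; exact: white_noise_measurable.
  move=> om _ /=; rewrite lee_fin [leRHS]ger0_norm ?addr_ge0 ?sqr_ge0//.
  rewrite ler_norml; have := sqr_ge0 (I h om - I g om); have := sqr_ge0 (I h om + I g om).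
  have := sqr_ge0 (I h om); have := sqr_ge0 (I g om); nra.
split=> //.
have H1 := centered_gaussian_Rintegral_sqr (inner2_ge0 h) (white_noise_gaussian hh).
have H2 := centered_gaussian_Rintegral_sqr (inner2_ge0 g) (white_noise_gaussian hg).
pose J := \int[P]_om (I h om * I g om).
have [v0 gs] := white_noise_add hh hg.
have i2 := integrableZl measurableT 2 ihg.
have iS := integrableD measurableT (integrableD measurableT ih i2) ig.
have E : \int[P]_om ((I h om + I g om) ^+ 2) = inner2 h h + 2 * J + inner2 g g.
  transitivity (\int[P]_om (I h om ^+ 2 + 2 * (I h om * I g om) + I g om ^+ 2)).
    by apply: eq_Rintegral => om _; ring.
  rewrite RintegralD//; last exact: (integrableD measurableT ih i2).
  by rewrite RintegralD// RintegralZl// H1 H2.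
have := centered_gaussian_Rintegral_sqr v0 gs; rewrite E -/J; lra.
Qed.

End white_noise.

(** * Heat integrands as Hermitian square-integrable functions *)

Section heat_integrands.
Context {R : realType}.
Notation leb := (@lebesgue_measure R).

(** Evenness of [g] and of the exponent makes the cosine part even and the sine part odd. Squaring
    doubles the time, so integrability is used at [s = 2 t]. *)
Lemma hermitian_heat (k : nat) (g : R -> R) (t x : R) : (0 < k)%N -> 0 < t ->
  measurable_fun setT g -> (forall l, g (- l) = g l) ->
  (forall s, 0 < s ->
    leb.-integrable setT (EFin \o (fun l => g l ^+ 2 * expR (- (s * l ^+ (2 * k)))))) ->
  hermitian_L2 (heat_integrand (2 * k) g t x).
Proof.
move=> k0 t0 mg ge ig.
have mE : measurable_fun setT (fun l : R => expR (- (l ^+ (2 * k) * t))).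
  by under eq_fun do rewrite mulrC; exact: measurable_expR_power.
have mc (f : R -> R) : continuous f -> measurable_fun setT (fun l : R => f (l * x)).
  move=> cf; apply: measurableT_comp; last exact: measurable_funM.
  exact: continuous_measurable_fun.
have sq (f : R -> R) : continuous f -> (forall y, `|f y| <= 1) ->
    measurable_fun setT (fun l : R => f (l * x) * expR (- (l ^+ (2 * k) * t)) * g l) /\
    leb.-integrable setT (fun l : R => ((f (l * x) * expR (- (l ^+ (2 * k) * t)) * g l) ^+ 2)%:E).
  move=> cf f1.
  have m1 : measurable_fun setT (fun l : R => f (l * x) * expR (- (l ^+ (2 * k) * t)) * g l).
    by apply: measurable_funM => //; apply: measurable_funM => //; exact: mc.
  split=> //; have t20 : 0 < 2 * t by rewrite mulr_gt0.
  have := ig _ t20; apply: le_integrable => //.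
    by apply/measurable_EFinP; exact: measurable_funX.
  move=> l _ /=; rewrite lee_fin [leRHS]ger0_norm; last first.
    by apply: mulr_ge0; [exact: sqr_ge0|exact: expR_ge0].
  rewrite ger0_norm ?sqr_ge0// !exprMn -expRM_natl mulrC ler_wpM2l ?sqr_ge0//.
  have -> : 2 * - (l ^+ (2 * k) * t) = - (2 * t * l ^+ (2 * k)) by ring.
  by rewrite ler_piMl ?expR_ge0// -[leLHS]real_normK ?num_real// exprn_ile1.
have [m1 i1] := sq _ (@continuous_cos R) (@cos_max R).
have [m2 i2] := sq _ (@continuous_sin R) (@sin_max R).
split=> //; split=> l /=.
- by rewrite mulNr cosN ge !exprM sqrrN.
- by rewrite mulNr sinN ge !exprM sqrrN !mulNr.
Qed.

Lemma inner2_heat (m : nat) (g : R -> R) (t x t' x' : R) :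
  inner2 (heat_integrand m g t x) (heat_integrand m g t' x') =
  \int[leb]_l (g l ^+ 2 * (cos (l * (x - x')) * expR (- ((t + t') * l ^+ m)))).
Proof.
apply: eq_Rintegral => l _ /=; rewrite mulrBr cosB.
have -> : - ((t + t') * l ^+ m) = - (l ^+ m * t) - l ^+ m * t' by ring.
by rewrite expRD; ring.
Qed.

End heat_integrands.

(** * The rescaled field and the limit of its covariances *)

Section rescaled_field.
Context {R : realType} {d : measure_display} {T : measurableType d}.
Variables (P : probability T R) (I : (R -> R) * (R -> R) -> T -> R).
Hypothesis WN : white_noise_integral P I.
Notation leb := (@lebesgue_measure R).

(** The convolution with [M] is constant in [om] and the white-noise integral is centered, so
    subtracting the mean removes exactly the convolution. *)
Lemma rescaled_fieldE (m : nat) (M f : R -> R) (eps t x : R) :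
  let h := heat_integrand m (fun l => Num.sqrt (f l)) (t * eps `^ (- (m%:R / 2)))
    (x * eps `^ (- (1 / 2))) in
  hermitian_L2 h ->
  rescaled_field P m M f I eps t x = fun om => eps `^ (- (1 / 4)) * I h om.
Proof.
move=> h hh; apply/funext => om; rewrite /rescaled_field /heat_solution -/h.
set c := Rintegral _ _ _; congr (_ * _).
suff -> : fine ('E_P[fun om => (c + I h om)%R])%E = c by ring.
rewrite unlock -/(Rintegral P setT (fun om => c + I h om)).
have ic : P.-integrable setT (EFin \o (fun=> c)).
  exact: (@bounded_integrable _ _ _ _ _ `|c|).
rewrite RintegralD//; last exact: white_noise_integrable hh.
by rewrite (white_noise_mean WN hh) Rintegral_cst//= probability_setT mulr1 addr0.
Qed.

Lemma powRN_half_ge (M eps : R) : 0 < M -> 0 < eps -> eps <= M ^- 2 ->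
  M <= eps `^ (- (1 / 2)).
Proof.
move=> M0 e0 eM; rewrite div1r powRN powR12_sqrt ?(ltW e0)//.
rewrite -[leLHS]invrK lef_pV2 ?posrE ?invr_gt0 ?sqrtr_gt0//.
have -> : M^-1 = Num.sqrt (M ^- 2).
  by rewrite -exprVn sqrtr_sqr gtr0_norm// invr_gt0.
exact: ler_wsqrtr.
Qed.

Lemma rescaled_inner2_cvg (k : nat) (f : R -> R) (t x t' x' : R) : (0 < k)%N ->
  0 < t -> 0 < t' -> (forall l, 0 <= f l) -> measurable_fun setT f ->
  (forall s, 0 < s ->
    leb.-integrable setT (EFin \o (fun l => f l * expR (- (s * l ^+ (2 * k)))))) ->
  {for 0, continuous f} ->
  let h eps t x := heat_integrand (2 * k) (fun l => Num.sqrt (f l))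
    (t * eps `^ (- ((2 * k)%:R / 2))) (x * eps `^ (- (1 / 2))) in
  ((eps `^ (- (1 / 4))) ^+ 2 * inner2 (h eps t x) (h eps t' x')) @[eps --> 0^'+] -->
  f 0 * \int[leb]_l (cos (l * (x - x')) * expR (- ((t + t') * l ^+ (2 * k)))).
Proof.
move=> k0 t0 t'0 f0 mf intf cf h; apply/cvgrPdist_le => e e0.
have s0 : 0 < t + t' by rewrite addr_gt0.
have [M M0 hM] := @heat_kernel_limit R k f k0 f0 mf intf (t + t') (x - x') s0 cf e e0.
near=> eps.
have eps0 : 0 < eps by near: eps; exact: nbhs_right_gt.
have epsM : eps <= M ^- 2.
  by near: eps; apply: nbhs_right_le; rewrite invr_gt0 exprn_gt0.
have /hM := powRN_half_ge M0 eps0 epsM; set a := eps `^ (- (1 / 2)).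
have -> : (eps `^ (- (1 / 4))) ^+ 2 = a.
  by rewrite -powR_mulrn ?powR_ge0// -powRrM; congr powR; field.
rewrite distrC inner2_heat.
have am : eps `^ (- ((2 * k)%:R / 2)) = a ^+ (2 * k).
  by rewrite -powR_mulrn ?powR_ge0// -powRrM; congr powR; field.
rewrite am -/a.
have -> : \int[leb]_l (Num.sqrt (f l) ^+ 2 * (cos (l * (x * a - x' * a)) *
    expR (- ((t * a ^+ (2 * k) + t' * a ^+ (2 * k)) * l ^+ (2 * k))))) =
  \int[leb]_l (f l * (cos (a * l * (x - x')) * expR (- ((t + t') * (a * l) ^+ (2 * k))))).
  apply: eq_Rintegral => l _; rewrite sqr_sqrtr// exprMn.
  by congr (_ * (cos _ * expR _)); ring.
by [].
Unshelve. all: by end_near. Qed.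

End rescaled_field.

(** * Assembly: convergence of the fields, then mean and covariance of the limit *)

Theorem theorem2 (R : realType) (d : measure_display) (T : measurableType d)
    (P : probability T R) (k n : nat) (M : R -> R) (A w kap : 'I_n.+1 -> R)
    (I : (R -> R) * (R -> R) -> T -> R) :
  (0 < k)%N ->
  white_noise_integral P I ->
  (* Assumption B *)
  (forall j, 0 <= A j) -> \sum_(j < n.+1) A j = 1 ->
  w ord0 = 0 -> (forall j, j != ord0 -> w j != 0) ->
  (forall j, 0 < kap j < 1) ->
  (* with A_0 = 0 *)
  A ord0 = 0 ->
  (* the convolution integrals are well defined *)
  (forall t x, 0 < t ->
     (@lebesgue_measure R).-integrable setT
       (fun y => (M (x - y) * fund_sol (2 * k) t y)%:E)) ->
  let m := (2 * k)%N in
  let f := spec_density A w kap in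
  let C := Cconst A w kap in
  fdd_converge P (rescaled_field P m M f I) (limit_field m C I) /\
  (forall t x t' x', 0 < t -> 0 < t' ->
     ('E_P[limit_field m C I t x] = 0)%E /\
     covariance P (limit_field m C I t x) (limit_field m C I t' x')
       = (C * Rintegral (@lebesgue_measure R) setT
              (fun l => cos (l * (x - x')) * expR (- ((t + t') * l ^+ m))))%:E /\
     C * Rintegral (@lebesgue_measure R) setT
              (fun l => cos (l * (x - x')) * expR (- ((t + t') * l ^+ m)))
       = 2 * Num.sqrt pi * C / (m%:R * powR (t + t') (m%:R^-1)) *
         FoxWright11 (m%:R^-1) (2 / m%:R) (1 / 2) 1
           (- ((x - x') ^+ 2 / (4 * powR (t + t') (2 / m%:R))))).
Proof.
move=> k0 WN A0 _ _ w0 kap01 Aord0 _ m f C.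
have f0 l : 0 <= f l by exact: spec_density_ge0.
have mf : measurable_fun setT f by exact: measurable_spec_density.
have intf s : 0 < s -> (@lebesgue_measure R).-integrable setT
    (EFin \o (fun l => f l * expR (- (s * l ^+ (2 * k))))).
  by move=> s0; exact: integrable_spec_density_heat.
have cf : {for 0, continuous f} by exact: continuous_spec_density0.
have fC : f 0 = C by exact: spec_density0.
have C0 : 0 <= C by rewrite -fC.
have h1 t x : 0 < t -> hermitian_L2 (heat_integrand m (fun=> 1 : R) t x).
  move=> t0; apply: hermitian_heat => // s s0; rewrite expr1n.
  by apply: (@integrable_heat_bounded R k s 1 (cst 1)) => // l; rewrite normr1.
have hf t x : 0 < t -> hermitian_L2 (heat_integrand m (fun l => Num.sqrt (f l)) t x).
  move=> t0; apply: hermitian_heat => //.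
  - apply: measurableT_comp => //; apply: continuous_measurable_fun.
    exact: sqrt_continuous.
  - by move=> l; rewrite /f spec_density_even.
  - move=> s s0; have := intf s s0.
    by apply: eq_integrable => // l _ /=; rewrite sqr_sqrtr.
have inn t x t' x' : inner2 (heat_integrand m (fun=> 1 : R) t x)
    (heat_integrand m (fun=> 1 : R) t' x') = Rintegral (@lebesgue_measure R) setT
      (fun l => cos (l * (x - x')) * expR (- ((t + t') * l ^+ m))).
  by rewrite inner2_heat; apply: eq_Rintegral => l _; rewrite expr1n mul1r.
split.
  move=> N pts pts0 phi cphi [B phiB].
  pose h eps i := heat_integrand m (fun l => Num.sqrt (f l))
    ((pts i).1 * powR eps (- (m%:R / 2))) ((pts i).2 * powR eps (- (1 / 2))).
  pose S eps i j := (powR eps (- (1 / 4))) ^+ 2 * inner2 (h eps i) (h eps j).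
  pose S0 i j := (Num.sqrt C) ^+ 2 * inner2
    (heat_integrand m (fun=> 1 : R) (pts i).1 (pts i).2)
    (heat_integrand m (fun=> 1 : R) (pts j).1 (pts j).2).
  apply: (@gaussian_family_cvg R d T P N _ _ S S0 phi B) => //.
  - near=> eps; have eps0 : 0 < eps by near: eps; exact: nbhs_right_gt.
    have hh i : hermitian_L2 (h eps i) by apply: hf; rewrite mulr_gt0 ?powR_gt0.
    rewrite (_ : (fun i => _) = (fun i om => powR eps (- (1 / 4)) * I (h eps i) om)).
      exact: white_noise_family.
    apply/funext => i.
    exact: (@rescaled_fieldE R d T P I WN m M f eps (pts i).1 (pts i).2 (hh i)).
  - by apply: white_noise_family => // i; exact: h1.
  (* The factor [sqrt C ^ 2] is [C], rewritten as [f 0], the constant produced by concentration at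
     frequency 0. *)
  - move=> i j; rewrite /S0 sqr_sqrtr// inn -fC.
    exact: rescaled_inner2_cvg.
move=> t x t' x' t0 t'0.
have mean0 s y : 0 < s -> ('E_P[limit_field m C I s y] = 0)%E.
  move=> s0; have ih := white_noise_integrable WN (h1 s y s0).
  rewrite unlock -[LHS]fineK; last first.
    exact: (integrable_fin_num measurableT (integrableZl measurableT (Num.sqrt C) ih)).
  rewrite -/(Rintegral P setT (limit_field m C I s y)) RintegralZl//.
  by rewrite (white_noise_mean WN (h1 s y s0)) mulr0.
split; first exact: mean0.
split.
  have [ihg Ehg] := white_noise_cov WN (h1 t x t0) (h1 t' x' t'0).
  rewrite unlock !mean0//= -inn -Ehg unlock.
  rewrite -RintegralZl// /Rintegral fineK; last first.
    exact: (integrable_fin_num measurableT (integrableZl measurableT C ihg)).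
  apply: eq_integral => om _; congr EFin.
  rewrite -[LHS]/((limit_field m C I t x om - 0) * (limit_field m C I t' x' om - 0)).
  rewrite !subr0 /limit_field.
  by rewrite mulrACA -expr2 sqr_sqrtr.
rewrite Rintegral_cos_heat ?addr_gt0//; ring.
Unshelve. all: by end_near. Qed.
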